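(* Let $1\le p\le\infty$, $0<\alpha\le r$, and $\omega\in\Omega_{w,p}$. Let $\{\mathcal L_n\}_{n\in\mathbb N}$ be bounded linear operators in $L_{w,p}$ such that $$T_h^{(a,b)}(\mathcal L_n(f))=\mathcal L_n(T_h^{(a,b)}f),\quad f\in L_{w,p},\ n\in\mathbb N,\ h\in(0,\pi).$$ If for all $f\in L_{w,p}$ the equivalence $$\|f-\mathcal L_n(f)\|_{w,p}\asymp\omega\Big(f,\frac1n\Big)_{w,p},\quad n\in\mathbb N,$$ holds, then for all $f\in H_{w,p}^{r,\alpha}$ $$\|f-\mathcal L_n(f)\|_{H_{w,p}^{r,\alpha}}\asymp\omega\Big(f,\frac1n\Big)_{H_{w,p}^{r,\alpha}},\quad n\in\mathbb N.$$
   Context: Fix real $a\ge b\ge -1/2$ and let $w(x)=(1-x)^a(1+x)^b$ on $[-1,1]$. For $1\le p<\infty$, $L_{w,p}$ is the space of measurable $f$ on $[-1,1]$ with $\|f\|_{w,p}=(\int_{-1}^1|f(x)|^pw(x)\,dx)^{1/p}<\infty$; for $p=\infty$, $L_{w,\infty}$ means $C[-1,1]$ with the maximum norm. Let $P_k^{(a,b)}$ $(k=0,1,\dots)$ be the Jacobi polynomials orthogonal on $[-1,1]$ with respect to $w$, normalized by $P_k^{(a,b)}(1)=\binom{k+a}{k}$, and put $R_k=P_k^{(a,b)}/P_k^{(a,b)}(1)$, $\mu_k=\|R_k\|_{w,2}^{-2}$, $c_k(f)=\int_{-1}^1 f(x)R_k(x)w(x)\,dx$, so that $f\sim\sum_{k\ge0}c_k(f)\mu_kR_k$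 (Fourier-Jacobi series). For $0<h<\pi$ the generalized Jacobi translation $T_h=T_h^{(a,b)}$ is the operator on $L_{w,p}$ given by $T_hf\sim\sum_k c_k(f)\mu_kR_k(\cos h)R_k$; it satisfies $\|T_hf\|_{w,p}\le\|f\|_{w,p}$. For real $r>0$ let $\widetilde\Delta_t^r=(I-T_t)^{r/2}=\sum_{k=0}^\infty(-1)^k\binom{r/2}{k}T_t^k$, $0<t<\pi$, and $\widetilde\omega_r(f,h)_{w,p}=\sup_{0<t\le h}\|\widetilde\Delta_t^rf\|_{w,p}$ for $0<h<\pi$, $\widetilde\omega_r(f,h)_{w,p}=\sup_{0<t<\pi}\|\widetilde\Delta_t^rf\|_{w,p}$ for $h\ge\pi$. The Hölder space $H_{w,p}^{r,\alpha}$ consists of $f\in L_{w,p}$ with $\|f\|_{H_{w,p}^{r,\alpha}}=\|f\|_{w,p}+\sup_{h>0}h^{-\alpha}\widetilde\omega_r(f,h)_{w,p}<\infty$. $\Omega_{w,p}$ is the class of functions $\omega=\omega(\cdot,\cdot)_{w,p}$ of $f\in L_{w,p}$ and $\delta>0$, with values in $[0,\infty)$, for which there is a constant $C$ independent of $f,g,\delta$ such that for all $f,g\in L_{w,p}$ and $\delta>0$: $\omega(f,\delta)_{w,p}\le C\|f\|_{w,p}$ and $\omega(f+g,\delta)_{w,p}\le C(\omega(f,\delta)_{w,p}+\omega(g,\delta)_{w,p})$. For such $\omega$, $$\omega(f,\delta)_{H_{w,p}^{r,\alpha}}=\omega(f,\delta)_{w,p}+\sup_{0<h<\pi}\frac{\omega(\widetilde\Delta_h^rf,\delta)_{w,p}}{h^\alpha}.$$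 $A(f,n)\asymp B(f,n)$ means that there is a constant $C>0$ with $C^{-1}A(f,n)\le B(f,n)\le CA(f,n)$ for all $f$ (in the indicated space) and all $n$. *)

(* Defs.v *)
From HB Require Import structures.
From mathcomp Require Import all_boot all_order all_algebra.
From mathcomp Require Import all_classical all_reals all_analysis.

Set Implicit Arguments.
Unset Strict Implicit.
Unset Printing Implicit Defensive.

Import Order.TTheory GRing.Theory Num.Theory.
Import numFieldNormedType.Exports.

Local Open Scope classical_set_scope.
Local Open Scope ring_scope.

(* A function on [-1, 1] is represented by any f : R -> R; its values outside
   [-1, 1] are irrelevant to everything below. *)

Section WeightedSpaces.
Variables (R : realType) (a b : R).
Implicit Types (p : \bar R) (f g : R -> R).

Local Notation I := (`[-1, 1]%classic : set R).
Local Notation leb := (@lebesgue_measure R).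

Definition jacobi_weight (x : R) : R := (1 - x) `^ a * (1 + x) `^ b.

Definition wnorm p f : \bar R :=
  match p with
  | q%:E => ((\int[leb]_(x in I) (`|f x| `^ q * jacobi_weight x)%:E)
              `^ q^-1)%E
  | +oo%E => ereal_sup [set (`|f x|)%:E | x in I]
  | -oo%E => 0%E
  end.

Definition Lw p : set (R -> R) :=
  match p with
  | q%:E => [set f | measurable_fun I f /\ (wnorm q%:E f < +oo)%E]
  | +oo%E => [set f | {within I, continuous f}]
  | -oo%E => set0
  end.

(* Equality of the elements of L_{w,p} represented by f and g. *)
Definition weq p f g : Prop :=
  match p with
  | q%:E => {ae leb, forall x, x \in I -> f x = g x}
  | _ => forall x, x \in I -> f x = g x
  end.

Definition gbinom (x : R) (k : nat) : R :=
  (\prod_(i < k) (x - i%:R)) / k`!%:R.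

(* These conditions determine P. *)
Definition jacobi_polynomials (P : nat -> {poly R}) : Prop :=
  [/\ forall k, size (P k) = k.+1,
      forall j k, j != k ->
        \int[leb]_(x in I) ((P j).[x] * (P k).[x] * jacobi_weight x) = 0
    & forall k, (P k).[1] = gbinom (k%:R + a) k].

Definition jacobiR (P : nat -> {poly R}) (k : nat) (x : R) : R :=
  (P k).[x] / (P k).[1].

Definition jacobi_mu (P : nat -> {poly R}) (k : nat) : R :=
  (fine (wnorm 2%:E (jacobiR P k))) ^- 2.

Definition jacobi_c (P : nat -> {poly R}) (k : nat) f : R :=
  \int[leb]_(x in I) (f x * jacobiR P k x * jacobi_weight x).

(* The coefficient of R_k in the Fourier-Jacobi series of f. *)
Definition fourier_jacobi_coef (P : nat -> {poly R}) (k : nat) f : R :=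
  jacobi_c P k f * jacobi_mu P k.

(* T h represents, for 0 < h < pi, the operator on L_{w,p} with
   T_h f ~ \sum_k c_k(f) mu_k R_k(cos h) R_k. *)
Definition jacobi_translation (P : nat -> {poly R}) p
    (T : R -> (R -> R) -> R -> R) : Prop :=
  forall (h : R) f, 0 < h < pi -> Lw p f ->
    Lw p (T h f) /\
    forall k, fourier_jacobi_coef P k (T h f) =
              jacobi_c P k f * jacobi_mu P k * jacobiR P k (cos h).

Definition bounded_linear_operator p (A : (R -> R) -> R -> R) : Prop :=
  [/\ forall f, Lw p f -> Lw p (A f),
      forall f g, Lw p f -> Lw p g -> weq p f g -> weq p (A f) (A g),
      forall (c : R) f g, Lw p f -> Lw p g ->
        weq p (A (fun x => c * f x + g x)) (fun x => c * A f x + A g x)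
    & exists C : R, forall f, Lw p f ->
        (wnorm p (A f) <= C%:E * wnorm p f)%E].

Section Difference.
Variables (p : \bar R) (T : R -> (R -> R) -> R -> R) (r : R).

Definition frac_diff_partial (t : R) f (N : nat) (x : R) : R :=
  \sum_(0 <= k < N) (-1) ^+ k * gbinom (r / 2) k * iter k (T t) f x.

(* A chosen representative of the sum, in the norm of L_{w,p}, of the series
   \sum_k (-1)^k binom(r/2,k) T_t^k f. *)
Definition frac_diff (t : R) f : R -> R :=
  xget (fun=> 0) [set g | Lw p g /\
    wnorm p (fun x => frac_diff_partial t f N x - g x) @[N --> \oo] --> 0%E].

Definition modulus f (h : R) : \bar R :=
  ereal_sup [set wnorm p (frac_diff t f) | t in
    [set t : R | if h < pi then 0 < t <= h else 0 < t < pi]].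

Definition holder_norm (alpha : R) f : \bar R :=
  (wnorm p f +
   ereal_sup [set ((h `^ (- alpha))%R)%:E * modulus f h | h in
     [set h : R | (0 < h)%R]])%E.

Definition Holder (alpha : R) : set (R -> R) :=
  [set f | Lw p f /\ (holder_norm alpha f < +oo)%E].

Definition omega_holder (alpha : R) (omega : (R -> R) -> R -> R)
    f (delta : R) : \bar R :=
  ((omega f delta)%:E +
   ereal_sup [set ((omega (frac_diff h f) delta / h `^ alpha)%R)%:E | h in
     [set h : R | (0 < h < pi)%R]])%E.

End Difference.

(* The second condition says that omega is a function of the element of
   L_{w,p}, not of its representative. *)
Definition Omega_class p (omega : (R -> R) -> R -> R) : Prop :=
  [/\ forall f delta, Lw p f -> 0 < delta -> 0 <= omega f delta,
      forall f g delta, Lw p f -> Lw p g -> 0 < delta -> weq p f g ->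
        omega f delta = omega g delta
    & exists C : R, forall f g delta, Lw p f -> Lw p g -> 0 < delta ->
        ((omega f delta)%:E <= C%:E * wnorm p f)%E /\
        omega (fun x => f x + g x) delta <= C * (omega f delta + omega g delta)].

End WeightedSpaces.

(* A(f,n) \asymp B(f,n) for f in X and n = 1, 2, ... *)
Definition equivalent_on (R : realType) (X : set (R -> R))
    (A B : (R -> R) -> nat -> \bar R) : Prop :=
  exists2 C : R, 0 < C & forall f n, X f -> (0 < n)%N ->
    (C^-1%:E * A f n <= B f n)%E /\ (B f n <= C%:E * A f n)%E.

(* Main.v *)
Require Import Defs.
From mathcomp Require Import all_boot all_order all_algebra.
From mathcomp Require Import all_classical all_reals all_analysis.
From mathcomp Require Import measurable_realfun lra ring.
Import Order.TTheory GRing.Theory Num.Theory.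
Import numFieldNormedType.Exports.
Local Open Scope classical_set_scope.
Local Open Scope ring_scope.

(** Write [D_t f] for the fractional difference [(I - T_t)^(r/2) f].  Since
    [L_n] is linear, bounded and commutes with [T_t], it commutes with the
    series in the powers of [T_t] that defines [D_t]; hence
    [D_t (f - L_n f) = D_t f - L_n (D_t f)] in L_{w,p}
    ([wnorm_frac_diff_error]).  The assumed equivalence may therefore be applied
    not only to [f] but also to each [D_t f], with one and the same constant:
    [||D_t (f - L_n f)||] is equivalent to [omega (D_t f, 1/n)].  Multiplying by
    [t^(-alpha)], taking the supremum over [0 < t < pi] and adding the
    equivalence for [f] gives the theorem, because the Hölder seminorm, a
    supremum over [h] of a supremum over [t <= h], collapses to a supremum of
    [t^(-alpha) ||D_t f||] over [0 < t < pi] ([holder_sup_modulus]).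

    Two facts are behind the displayed identity.

    - The series defining [D_t f] converges in norm ([frac_diff_spec]).  The
      binomial coefficients of [r/2 > 0] are absolutely summable
      ([gbinom_abs_summable]), [T_t] is a contraction, and L_{w,p} is complete
      ([Lw_complete]).  For finite [p], completeness is the theorem of Riesz and
      Fischer on the line ([Lnorm_series_cvg]), transported by
      [f |-> f * w^(1/p)]; for infinite [p], it is the continuity of uniform
      limits.

    - [T_t], which is known only through the Fourier-Jacobi coefficients of
      [T_t f], is linear up to equality in L_{w,p} ([translation_lin]).  This
      rests on the uniqueness theorem: a function of L_{w,p} all of whose
      coefficients vanish is zero ([fourier_jacobi_unique]).  As [w] is
      integrable ([integrable_jacobi_weight]), [F = f w] is integrable, and it
      is orthogonal to every polynomial because the [P_k] span all of them.  The
      polynomials [(1 - x^n)^m] with [m] close to [c^(-n)] are bounded by 1 and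
      converge to the indicator of [x < c] on [0, 1]; by dominated convergence
      every half-line integral of [F] vanishes, so that [F = 0] almost
      everywhere by Lebesgue differentiation ([moments_ae0]). *)

(** * Polynomials converging to a step *)

Section Steps.
Variable R : realType.
Implicit Types x c u : R.

Lemma bernoulli_ge u m : -1 <= u -> 1 + u *+ m <= (1 + u) ^+ m.
Proof.
move=> u1; elim: m => [|m IH]; first by rewrite mulr0n addr0 expr0.
rewrite exprS; apply: le_trans (ler_wpM2l _ IH); last lra.
rewrite mulrSr -(mulr_natr u m).
(* The term by which the induction step exceeds [1 + (m + 1) u]. *)
have h : 0 <= u ^+ 2 * m%:R by rewrite mulr_ge0// sqr_ge0.
nra.
Qed.

(** An integer between [c^(-n)] and [c^(-n) + 1]: then [m * x^n] behaves like
    [(x/c)^n], which tends to 0 or to infinity according to the side of [c]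
    on which [x] lies. *)
Definition step_exponent c n : nat := (Num.truncn (c^-1 ^+ n)).+1.

Definition step_poly c n : {poly R} := (1 - 'X^n) ^+ step_exponent c n.

Lemma step_polyE c n x : (step_poly c n).[x] = (1 - x ^+ n) ^+ step_exponent c n.
Proof. by rewrite /step_poly horner_exp !hornerE. Qed.

Lemma step_poly_bounds c n x : 0 <= x <= 1 -> 0 <= (step_poly c n).[x] <= 1.
Proof.
move=> /andP[x0 x1]; rewrite step_polyE.
have u0 : 0 <= x ^+ n by exact: exprn_ge0.
have u1 : x ^+ n <= 1 by exact: exprn_ile1.
by rewrite exprn_ge0 ?subr_ge0//= exprn_ile1// ?subr_ge0// lerBlDr lerDl.
Qed.

(** For [x < c], Bernoulli's inequality gives [1 - m x^n] as a lower bound,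
    and [m x^n <= (x/c)^n + x^n].  For [x > c], the same inequality for
    [(1 + x^n)^m] and [(1 - x^n)(1 + x^n) <= 1] give the upper bound
    [1 / (m x^n) <= (c/x)^n]. *)
Lemma step_poly_cvg c x : 0 < c < 1 -> 0 <= x <= 1 -> x != c ->
  (step_poly c n).[x] @[n --> \oo] --> ((x < c)%R%:R : R).
Proof.
move=> /andP[c0 c1] x01 xc; have /andP[x0 x1] := x01.
have geo z : 0 <= z < 1 -> z ^+ n @[n --> \oo] --> (0 : R).
  by move=> /andP[z0 z1]; apply: cvg_expr; rewrite ger0_norm.
have m_gt n : c^-1 ^+ n < (step_exponent c n)%:R by exact: truncnS_gt.
have m_le n : (step_exponent c n)%:R <= c^-1 ^+ n + 1.
  rewrite /step_exponent -natr1 lerD2r.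
  have := @truncn_itv R (c^-1 ^+ n); case/(_ _)/andP => //.
  by rewrite exprn_ge0// invr_ge0 ltW.
have [xltc|cltx|xeqc] := ltgtP x c; last by rewrite xeqc eqxx in xc.
- have lim1 : 1 - ((x / c) ^+ n + x ^+ n) @[n --> \oo] --> (1 - (0 + 0) : R).
    apply: cvgB; first exact: cvg_cst.
    apply: cvgD; apply: geo.
      by apply/andP; split; [apply: divr_ge0 => //; exact: ltW|rewrite ltr_pdivrMr// mul1r].
    by rewrite x0 (lt_trans xltc).
  rewrite addr0 subr0 in lim1.
  apply: (@squeeze_cvgr _ _ _ _ _ (cst 1) _ _ _ lim1 (cvg_cst _)).
  apply: nearW => n; have /andP[_ ->] := step_poly_bounds c n x x01.
  rewrite andbT step_polyE.
  have u1 : x ^+ n <= 1 by exact: exprn_ile1.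
  apply: le_trans (bernoulli_ge _ _ _); last lra.
  rewrite mulNrn lerD2l lerN2 -(mulr_natr (x ^+ n)) expr_div_n -exprVn.
  rewrite (le_trans (ler_wpM2l _ (m_le n)))//; first exact: exprn_ge0.
  by rewrite mulrDr mulr1.
- have lim0 : (c / x) ^+ n @[n --> \oo] --> (0 : R).
    have xp : 0 < x := lt_trans c0 cltx.
    by apply: geo; apply/andP; split; [apply: divr_ge0 => //; exact: ltW|rewrite ltr_pdivrMr// mul1r].
  apply: (@squeeze_cvgr _ _ _ _ (cst 0) _ _ _ _ (cvg_cst _) lim0).
  apply: nearW => n; have /andP[-> _] := step_poly_bounds c n x x01.
  rewrite /= step_polyE.
  set m := step_exponent c n; set u := x ^+ n.
  have xp : 0 < x := lt_trans c0 cltx.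
  have u0 : 0 < u by exact: exprn_gt0.
  have u1 : u <= 1 by exact: exprn_ile1.
  have m0 : 0 < m%:R :> R by rewrite ltr0n.
  have ub : (1 - u) ^+ m * (u * m%:R) <= 1.
    apply: (@le_trans _ _ ((1 - u) ^+ m * (1 + u) ^+ m)).
      rewrite ler_wpM2l ?exprn_ge0 ?subr_ge0//.
      apply: le_trans (bernoulli_ge u m _); last lra.
      by rewrite -(mulr_natr u) lerDr.
    by rewrite -exprMn; apply: exprn_ile1; [apply: mulr_ge0; lra|nra].
  have cn : 0 < c ^+ n by exact: exprn_gt0.
  have : (1 - u) ^+ m <= (u * m%:R)^-1.
    by rewrite -[leRHS]mul1r ler_pdivlMr// mulr_gt0.
  move=> /le_trans; apply; rewrite expr_div_n -/u.
  rewrite invfM mulrC ler_pM2r ?invr_gt0//.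
  rewrite -[leRHS]invrK lef_pV2 ?posrE ?invr_gt0// -exprVn ltW//.
Qed.

End Steps.

(** * A function orthogonal to all polynomials vanishes almost everywhere *)

Section Moments.
Variable R : realType.
Local Notation leb := (@lebesgue_measure R).
Local Notation I := (`[-1, 1]%classic : set R).

Lemma ae_neq (y : R) : {ae leb, forall x, x != y}.
Proof.
exists [set y]; split => //; first exact: lebesgue_measure_set1.
by move=> x /= /negP; rewrite negbK => /eqP.
Qed.

Lemma within_continuous_bounded (f : R -> R) :
  {within I, continuous f} -> [bounded f x | x in I].
Proof.
move=> cf; have cI : compact I by exact: segment_compact.
have /compact_bounded[M [_ mrt]] := continuous_compact cf cI.
by exists M; split; rewrite ?num_real // => ? ? ? ?; exact: mrt.
Qed.

Lemma itv_poly_bounded (q : {poly R}) : [bounded q.[x] | x in I].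
Proof.
by apply: within_continuous_bounded; apply: continuous_subspaceT => x;
  exact: continuous_horner.
Qed.

Lemma integrable_mul_poly (F : R -> R) (q : {poly R}) :
  leb.-integrable I (EFin \o F) ->
  leb.-integrable I (EFin \o (fun x => F x * q.[x])).
Proof.
move=> iF.
have := @integrableMr _ _ _ leb I (measurable_itv _) (horner q) (EFin \o F)
  (@measurable_poly _ q _) (itv_poly_bounded q) iF.
by apply: eq_integrable => // x _ /=; rewrite -EFinM mulrC.
Qed.

(** The step polynomials, transported to [-1, 1] by [x |-> (x + 1) / 2],
    multiply [F] to an integrand dominated by [|F|] whose integral is 0; it
    tends to [F] cut off to the right of [y].  The interval is open at -1 so
    that it is empty when [y <= -1]. *)
Lemma moments_halfline (F : R -> R) :
  leb.-integrable I (EFin \o F) ->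
  (forall q : {poly R}, \int[leb]_(x in I) (F x * q.[x]) = 0) ->
  forall y, \int[leb]_(x in I) (F \_ `]-1, y]) x = 0.
Proof.
move=> iF mom y; rewrite -Rintegral_mkcondr.
have [y1|y1] := leP y (-1).
  rewrite (_ : _ `&` _ = set0) ?Rintegral_set0//.
  apply/seteqP; split => // x [_]/=; rewrite in_itv/= => /andP[a b]; lra.
have [y2|y2] := leP 1 y.
  rewrite (_ : _ `&` _ = `]-1, 1]%classic); last first.
    apply/seteqP; split => x /=; rewrite !in_itv/=.
      by move=> [/andP[a b] /andP[c d]]; lra.
    by move=> /andP[a b]; split; lra.
  rewrite Rintegral_itv_obnd_cbnd.
    rewrite -[RHS](mom 1%:P); apply: eq_Rintegral => x _.
    by rewrite hornerC mulr1.
  by apply: integrableS iF => //; apply: subset_itv; rewrite bnd_simp.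
rewrite Rintegral_mkcondr.
pose c := (y + 1) / 2.
pose s n : {poly R} := step_poly R c n \Po (2^-1 *: ('X + 1%:P)).
have sE n x : (s n).[x] = (step_poly R c n).[(x + 1) / 2].
  by rewrite horner_comp !hornerE mulrC.
have itvP x : I x -> 0 <= (x + 1) / 2 <= 1.
  by rewrite /= in_itv/= => /andP[a b]; apply/andP; lra.
have mF : measurable_fun I F by apply/measurable_EFinP; exact: measurable_int iF.
have mlim : measurable_fun I (EFin \o (F \_ `]-1, y])).
  apply/measurable_EFinP; apply/(measurable_restrict (E := I)) => //.
  by apply: measurable_funS mF => //; exact: subIsetl.
have lim : {ae leb, forall x, I x ->
    (F x * (s n).[x])%:E @[n --> \oo] --> (EFin \o (F \_ `]-1, y])) x}.
  apply: (@filterS2 _ _ (ae_filter_ringOfSetsType leb) _ _ _ _ (ae_neq y) (ae_neq (-1))) => x xy x1 Ix.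
  apply: cvg_EFin; first exact: nearW.
  have -> : (F \_ `]-1, y]) x = F x * ((x + 1) / 2 < c)%R%:R.
    rewrite patchE; case: ifPn => [|].
      rewrite inE/= in_itv/= => /andP[u v].
      have -> : (x + 1) / 2 < c by rewrite /c; move: xy; rewrite neq_lt; lra.
      by rewrite mulr1.
    move=> /negP H; have -> : ((x + 1) / 2 < c) = false.
      apply/negP => xc; apply: H; rewrite inE/= in_itv/=.
      move: Ix x1; rewrite /= in_itv/= neq_lt => /andP[u v] d.
      by move: xc; rewrite /c => xc; lra.
    by rewrite mulr0.
  rewrite (_ : _ \o _ = (fun n => F x * (step_poly R c n).[(x + 1) / 2])); last first.
    by apply/funext => n /=; rewrite sE.
  apply: cvgM; first exact: cvg_cst.
  apply: step_poly_cvg; [by rewrite /c; apply/andP; lra|exact: itvP|].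
  by apply: contra xy => /eqP; rewrite /c => h; apply/eqP; lra.
have dom : {ae leb, forall x n, I x ->
    (`|(F x * (s n).[x])%:E| <= (abse \o (EFin \o F)) x)%E}.
  apply: aeW => x n Ix; rewrite /= lee_fin normrM ler_piMr//.
  have := step_poly_bounds R c n _ (itvP _ Ix); rewrite -sE => /andP[u v].
  by rewrite ger0_norm.
have [_ _] := @dominated_convergence _ _ _ leb I (measurable_itv _)
  (fun n x => (F x * (s n).[x])%:E) (EFin \o (F \_ `]-1, y])) _
  (fun n => measurable_int _ (integrable_mul_poly _ (s n) iF))
  mlim lim (integrable_abse iF) dom.
rewrite (_ : [sequence _]_n = cst 0%E); last first.
  apply/funext => n /=.
  transitivity ((\int[leb]_(x in I) (F x * (s n).[x]))%:E); last by rewrite mom.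
  rewrite /Rintegral fineK//; apply: integrable_fin_num => //.
  exact: integrable_mul_poly.
move=> {}lim.
have := cvg_unique _ lim (@cvg_cst _ (0 : \bar R) _ _ _).
by rewrite /Rintegral /= => ->.
Qed.

(** The primitive of [F] is identically 0, hence so is its derivative, which
    is [F] almost everywhere. *)
Lemma moments_ae0 (F : R -> R) :
  leb.-integrable I (EFin \o F) ->
  (forall q : {poly R}, \int[leb]_(x in I) (F x * q.[x]) = 0) ->
  {ae leb, forall x, I x -> F x = 0}.
Proof.
move=> iF mom.
have iFI : leb.-integrable setT (EFin \o (F \_ I)).
  by rewrite -restrict_EFin; apply/integrable_restrict => //=; rewrite setTI.
have iJ y : leb.-integrable `]-1, y] (EFin \o (F \_ I)).
  exact: integrableS iFI.
have loc : locally_integrable [set: R] (F \_ I) by exact: integrable_locally.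
have := FTC1 iJ loc.
apply: (@filterS2 _ _ (ae_filter_ringOfSetsType leb) _ _ _ _ (ae_neq (-1))) => x xn1 + Ix.
have -> : (fun x => \int[leb]_(t in `]-1, x]) (F \_ I) t) = cst 0.
  apply/funext => y; rewrite -Rintegral_mkcondl Rintegral_mkcondr.
  exact: moments_halfline.
have xlt : (BRight (-1) < BRight x)%O.
  rewrite bnd_simp; move: Ix xn1; rewrite /= in_itv/= => /andP[a _].
  by rewrite lt_neqAle eq_sym a andbT.
by move=> /(_ xlt)[_]; rewrite derive1_cst patchE mem_set// => <-.
Qed.

End Moments.

(** * Absolutely convergent series in L_q of a measure *)

(** The epsilon form of convergence to 0 in the extended reals; it is stated
    without [fine], and covers sequences with finitely many infinite terms. *)
Lemma nneg_cvge0P (R : realType) (y : nat -> \bar R) :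
  (forall n, (0 <= y n)%E) ->
  (y n @[n --> \oo] --> 0%E) <->
  (forall e : R, 0 < e -> \forall n \near \oo, (y n <= e%:E)%E).
Proof.
move=> y0; split.
  move=> /fine_cvgP[yfin /cvgrPdist_le y_cvg] e e0.
  near=> n.
  have yf : y n \is a fin_num by near: n.
  have : `|0 - fine (y n)| <= e by near: n; exact: y_cvg.
  by rewrite sub0r normrN ger0_norm ?fine_ge0// -lee_fin fineK.
move=> small; apply/fine_cvgP; split.
  have := small 1 ltr01; apply: filterS => n yn.
  by rewrite ge0_fin_numE//; apply: le_lt_trans yn _; exact: ltry.
apply/cvgrPdist_le => e e0; have := small e e0; apply: filterS => n yn.
rewrite sub0r normrN ger0_norm ?fine_ge0// -lee_fin fineK//.
by rewrite ge0_fin_numE//; apply: le_lt_trans yn _; exact: ltry.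
Unshelve. all: by end_near. Qed.

Lemma powR_le_self (R : realType) (x q : R) : 1 <= q -> 0 <= x <= 1 -> x `^ q <= x.
Proof.
move=> q1 /andP[]; rewrite le_eqVlt => /predU1P[<- _|x0 x1].
  by rewrite powR0// gt_eqF//; lra.
by apply: ge1r_powR => //; rewrite x0.
Qed.

Lemma poweR_cvg0 (R : realType) (s : R) (y : nat -> \bar R) : 0 < s ->
  (forall n, (0 <= y n)%E) -> y n @[n --> \oo] --> 0%E ->
  (y n `^ s)%E @[n --> \oo] --> 0%E.
Proof.
move=> s0 y0 /(nneg_cvge0P _ _ y0) small; apply/nneg_cvge0P.
  by move=> n; exact: poweR_ge0.
move=> e e0; have := small (e `^ s^-1) (powR_gt0 _ e0); apply: filterS => n yn.
rewrite -[e in e%:E](powRr1 (ltW e0)) -(mulVf (lt0r_neq0 s0)) powRrM -poweR_EFin.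
apply: gt0_ler_poweR => //; first exact: ltW.
  by rewrite in_itv/= y0 leey.
by rewrite in_itv/= lee_fin powR_ge0 leey.
Qed.

Section RieszFischer.
Context d (T : measurableType d) (R : realType).
Variable mu : {measure set T -> \bar R}.
Variable q : R.
Hypothesis q1 : 1 <= q.
Local Notation "'N[ f ]" := (Lnorm mu q%:E (EFin \o f)) (format "''N[' f ]").

Let q0 : 0 < q. Proof. exact: lt_le_trans q1. Qed.

Lemma le_Lnorm (f g : T -> R) : measurable_fun setT f -> measurable_fun setT g ->
  (forall x, `|f x| <= `|g x|) -> ('N[f] <= 'N[g])%E.
Proof.
move=> mf mg fg; rewrite unlock.
have mp (h : T -> R) : measurable_fun setT h ->
    measurable_fun setT (fun x => (`|(EFin \o h) x| `^ q)%E).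
  move=> mh; apply: (measurableT_comp (measurable_poweR q)).
  by apply: measurableT_comp => //; exact/measurable_EFinP.
apply: gt0_ler_poweR; first by rewrite invr_ge0 ltW.
- by rewrite in_itv/= leey andbT integral_ge0// => x _; exact: poweR_ge0.
- by rewrite in_itv/= leey andbT integral_ge0// => x _; exact: poweR_ge0.
apply: ge0_le_integral => //.
- by move=> x _; exact: poweR_ge0.
- exact: mp.
- exact: mp.
- move=> x _; rewrite lee_fin.
  by apply: ge0_ler_powR; rewrite ?nnegrE//; exact: ltW.
Qed.

Lemma Lnorm_sum_le (u : nat -> T -> R) N :
  (forall k, measurable_fun setT (u k)) ->
  ('N[(fun x => \sum_(0 <= k < N) u k x)%R] <= \sum_(0 <= k < N) 'N[u k])%E.
Proof.
move=> mu_; elim: N => [|N IH].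
  rewrite big_geq// (_ : EFin \o _ = cst 0%E) ?Lnorm0//; last first.
    by apply/funext => x /=; rewrite big_geq.
  by rewrite eqe gt_eqF.
rewrite big_nat_recr//= (_ : (fun _ => _) =
    (fun x => \sum_(0 <= k < N) u k x) \+ u N)%R; last first.
  by apply/funext => x; rewrite big_nat_recr.
apply: le_trans (minkowski_EFin _ _ _ _) _ => //.
  exact: measurable_sum.
exact: leeD.
Qed.

(** The theorem of Riesz and Fischer for series.  The q-th powers of the
    partial sums of [|u_k|] increase to an integrable function [G] by
    Minkowski's inequality and monotone convergence, so the series converges
    absolutely wherever [G] is finite; and [G] dominates the q-th powers of
    the distances of the partial sums to their limit. *)
Lemma Lnorm_series_cvg (u : nat -> T -> R) (M : R) :
  (forall k, measurable_fun setT (u k)) ->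
  (forall N, (\sum_(0 <= k < N) 'N[u k] <= M%:E)%E) ->
  exists2 g : T -> R, measurable_fun setT g &
    'N[(fun x => \sum_(0 <= k < N) u k x - g x)] @[N --> \oo] --> 0%E.
Proof.
move=> mu_ uM.
pose S N x := \sum_(0 <= k < N) u k x.
pose A N x := \sum_(0 <= k < N) `|u k x|.
have mS N : measurable_fun setT (S N) by exact: measurable_sum.
have mA N : measurable_fun setT (A N).
  by apply: measurable_sum => k; exact: measurableT_comp.
have A_ge0 N x : 0 <= A N x by exact: sumr_ge0.
have A_nd x : {homo A^~ x : m n / (m <= n)%N >-> m <= n}.
  move=> m n mn; rewrite /A (big_cat_nat _ mn)//= lerDl.
  by rewrite big_seq sumr_ge0.
have S_dist m n x : (m <= n)%N -> `|S m x - S n x| <= A n x.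
  move=> mn; have -> : S n x = S m x + \sum_(m <= k < n) u k x.
    by rewrite /S (@big_cat_nat _ _ _ m 0 n).
  rewrite opprD addrA subrr sub0r normrN.
  apply: le_trans (ler_norm_sum _ _ _) _.
  by rewrite /A (@big_cat_nat _ _ _ m 0 n)//= lerDr sumr_ge0.
have N_A N : ('N[A N] <= M%:E)%E.
  apply: le_trans (uM N); apply: le_trans (Lnorm_sum_le _ _ _) _.
    by move=> k; exact: measurableT_comp.
  by apply: lee_sum => k _; rewrite -[leRHS]Lnorm_abse.
pose Aq N x := ((A N x) `^ q)%:E.
have mAq N : measurable_fun setT (Aq N).
  by apply/measurable_EFinP; apply: (measurableT_comp (measurable_powR q)).
have Aq_nd x : {homo Aq^~ x : m n / (m <= n)%N >-> (m <= n)%E}.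
  move=> m n mn; rewrite lee_fin; apply: ge0_ler_powR; rewrite ?nnegrE//.
    exact: ltW.
  exact: A_nd.
have Aq_cvg x : Aq N x @[N --> \oo] --> limn (Aq^~ x).
  exact: ereal_nondecreasing_is_cvgn.
pose G x := limn (Aq^~ x).
have Aq_le N x : (Aq N x <= G x)%E.
  by apply: lime_ge; [exact: Aq_cvg|exists N => // n /= Nn; exact: Aq_nd].
have G_ge0 x : (0 <= G x)%E by apply: le_trans (Aq_le 0%N x); rewrite lee_fin powR_ge0.
have mG : measurable_fun setT G.
  by apply: emeasurable_fun_cvg mAq _ => x _; exact: Aq_cvg.
have IAq N : (\int[mu]_x Aq N x <= (M%:E `^ q))%E.
  have -> : (\int[mu]_x Aq N x = 'N[A N] `^ q)%E.
    rewrite powR_Lnorm; last by rewrite gt_eqF.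
    by apply: eq_integral => x _; rewrite /= ger0_norm.
  apply: gt0_ler_poweR; [exact: ltW| | |exact: N_A].
    by rewrite in_itv/= Lnorm_ge0 leey.
  by rewrite in_itv/= leey andbT; apply: le_trans (N_A 0%N); exact: Lnorm_ge0.
have iG : mu.-integrable setT G.
  apply/integrableP; split => //.
  under eq_integral do rewrite gee0_abs//.
  have GI : (\int[mu]_x Aq N x)%E @[N --> \oo] --> (\int[mu]_x G x)%E.
    apply: cvg_monotone_convergence => //.
    by move=> n x _; rewrite lee_fin powR_ge0.
  apply: (@le_lt_trans _ _ (M%:E `^ q)%E); last by rewrite poweR_EFin ltry.
  by apply: cvge_le GI; exact: nearW.
(* An upper limit is measurable whether or not the limit exists. *)
pose g x := fine (limn_esup (fun N => (S N x)%:E)).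
have mg : measurable_fun setT g.
  apply: (measurableT_comp (fine_measurable measurableT)).
  by apply: measurable_fun_limn_esup => N; exact/measurable_EFinP.
have Gfin_bound x N : G x \is a fin_num -> A N x <= (fine (G x)) `^ q^-1.
  move=> Gx; rewrite -[A N x](powRr1 (A_ge0 N x)) -(mulfV (lt0r_neq0 q0)) powRrM.
  apply: ge0_ler_powR; rewrite ?nnegrE ?powR_ge0 ?fine_ge0//.
    by rewrite invr_ge0 ltW.
  by rewrite -lee_fin fineK//; exact: Aq_le.
have S_cvg x : G x \is a fin_num -> S N x @[N --> \oo] --> g x.
  move=> Gx.
  have Scvg : cvgn (S^~ x).
    have := @normed_cvg R R^o (u^~ x) _; apply.
    apply: nondecreasing_is_cvgn; first exact: A_nd.
    by exists (fine (G x) `^ q^-1) => _ [N _ <-]; exact: Gfin_bound.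
  have -> : g x = limn (S^~ x); last exact: Scvg.
  rewrite /g is_cvg_limn_esupE; last first.
    by apply/cvg_ex; exists (limn (S^~ x))%:E; apply: cvg_EFin => //; exact: nearW.
  by rewrite EFin_lim.
have dist_le x N : G x \is a fin_num -> `|S N x - g x| `^ q <= fine (G x).
  move=> Gx; rewrite -[leRHS]powRr1 ?fine_ge0// -(mulVf (lt0r_neq0 q0)) powRrM.
  apply: ge0_ler_powR; rewrite ?nnegrE ?powR_ge0//; first exact: ltW.
  have lim : `|S N x - S n x| @[n --> \oo] --> `|S N x - g x|.
    by apply: cvg_norm; apply: cvgB; [exact: cvg_cst|exact: S_cvg].
  rewrite -(cvg_lim _ lim)//; apply: limr_le.
    by apply/cvg_ex; eexists; exact: lim.
  by exists N => // n /= Nn; apply: le_trans (S_dist _ _ _ Nn) _; exact: Gfin_bound.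
have aefin := integrable_ae measurableT iG.
exists g => //.
have mD N : measurable_fun setT (fun x => (`|S N x - g x| `^ q)%:E).
  apply/measurable_EFinP; apply: (measurableT_comp (measurable_powR q)).
  by apply: measurableT_comp => //; exact: measurable_funB.
have lim0 : {ae mu, forall x, setT x ->
    (`|S N x - g x| `^ q)%:E @[N --> \oo] --> cst 0%E x}.
  move: aefin; apply: filterS => x /(_ Logic.I) Gx _.
  apply/nneg_cvge0P; first by move=> n; rewrite lee_fin powR_ge0.
  (* [y^q <= y] requires [y <= 1], hence the minimum. *)
  move=> e e0; have me : 0 < Num.min e 1 by rewrite lt_min e0 ltr01.
  have /cvgrPdist_le/(_ _ me) := S_cvg x Gx.
  apply: filterS => n; rewrite distrC le_min lee_fin => /andP[h1 h2].
  apply: le_trans h1; apply: powR_le_self => //.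
  by rewrite normr_ge0.
have dom : {ae mu, forall x N, setT x -> (`|(`|S N x - g x| `^ q)%:E| <= G x)%E}.
  move: aefin; apply: filterS => x /(_ Logic.I) Gx N _.
  by rewrite gee0_abs ?lee_fin ?powR_ge0// -(fineK Gx) lee_fin dist_le.
have [_ _] := dominated_convergence measurableT mD (measurable_cst _) lim0 iG dom.
rewrite integral0 => lim.
rewrite unlock; apply: poweR_cvg0.
- by rewrite invr_gt0.
- by move=> n; apply: integral_ge0 => x _; exact: poweR_ge0.
- exact: lim.
Qed.

End RieszFischer.

(** * The Jacobi weight *)

Section Weight.
Variables (R : realType) (a b : R).
Local Notation leb := (@lebesgue_measure R).
Local Notation I := (`[-1, 1]%classic : set R).
Local Notation w := (jacobi_weight a b).

Lemma jacobi_weight_ge0 x : 0 <= w x.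
Proof. by rewrite mulr_ge0// powR_ge0. Qed.

Lemma jacobi_weight_gt0 x : -1 < x < 1 -> 0 < w x.
Proof.
by move=> /andP[x1 x2]; rewrite mulr_gt0// powR_gt0; lra.
Qed.

Lemma jacobi_weight_ae_neq0 : {ae leb, forall x, I x -> w x != 0}.
Proof.
apply: (@filterS2 _ _ (ae_filter_ringOfSetsType leb) _ _ _ _ (ae_neq R 1) (ae_neq R (-1)))
  => x x1 xn1 Ix; apply: lt0r_neq0; apply: jacobi_weight_gt0.
move: Ix x1 xn1; rewrite /= in_itv/= => /andP[u v].
by rewrite !neq_lt => s t; apply/andP; split; lra.
Qed.

Lemma measurable_jacobi_weight : measurable_fun setT w.
Proof.
apply: measurable_funM.
  apply: (measurableT_comp (measurable_powR a)).
  exact: measurable_funB.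
apply: (measurableT_comp (measurable_powR b)).
exact: measurable_funD.
Qed.

Lemma measurable_powR_weight (q : R) (f : R -> R) : measurable_fun I f ->
  measurable_fun I (fun x => `|f x| `^ q * w x).
Proof.
move=> mf; apply: measurable_funM; last first.
  by apply: measurable_funTS; exact: measurable_jacobi_weight.
apply: (measurableT_comp (measurable_powR _)).
exact: measurableT_comp.
Qed.

(** The derivative of [asin] on ]-1, 1[, written as a power so that it is
    visibly measurable on the whole line. *)
Definition arcsine_density (x : R) : R := (1 - x ^+ 2) `^ (- 2^-1).

(** For [s >= -1/2] and [0 < u <= 2], [u^s <= 2^(s + 1/2) * u^(-1/2)]; the
    product of these bounds at [1 - x] and [1 + x] is a multiple of the
    arcsine density. *)
Lemma jacobi_weight_le_arcsine x : - (1 / 2) <= b -> b <= a -> -1 < x < 1 ->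
  w x <= 2 `^ (a + 2^-1) * 2 `^ (b + 2^-1) * arcsine_density x.
Proof.
move=> hb hab /andP[x1 x2].
have half u s : 0 < u <= 2 -> - (1 / 2) <= s ->
    u `^ s <= 2 `^ (s + 2^-1) * (u `^ 2^-1)^-1.
  move=> /andP[u0 u2] hs.
  have -> : u `^ s = u `^ (s + 2^-1) * (u `^ 2^-1)^-1.
    rewrite -powRN -powRD; first by congr (_ `^ _); ring.
    by apply/implyP => _; rewrite gt_eqF.
  rewrite ler_wpM2r ?invr_ge0 ?powR_ge0//.
  by apply: ge0_ler_powR; rewrite ?nnegrE; lra.
rewrite /arcsine_density powRN.
rewrite (_ : 1 - x ^+ 2 = (1 - x) * (1 + x)); last ring.
rewrite powRM; [|lra|lra].
rewrite invfM mulrACA /jacobi_weight.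
by apply: ler_pM; rewrite ?powR_ge0//; apply: half; lra.
Qed.

Lemma measurable_arcsine_density : measurable_fun setT arcsine_density.
Proof.
apply: (measurableT_comp (measurable_powR _)).
by apply: measurable_funB => //; exact: measurable_funX.
Qed.

(** The density is unbounded at both ends, so the fundamental theorem of
    calculus is applied on an increasing sequence of compact subintervals,
    where the integral is at most the total variation [pi] of [asin]. *)
Lemma arcsine_integral_lty : (\int[leb]_(x in `](-1)%R, 1%R[) (arcsine_density x)%:E < +oo)%E.
Proof.
pose e n : R := 1 - n.+2%:R^-1.
have e0 n : 0 < e n < 1.
  rewrite /e subr_gt0 invf_lt1 ?ltr1n//= ltrBlDr ltrDl invr_gt0//.
pose F n := `[- e n, e n]%classic.
have Fn n : (\int[leb]_(x in F n) (arcsine_density x)%:E <= pi%:E)%E.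
  have /andP[en0 en1] := e0 n.
  have inF x : x \in `[- e n, e n] -> -1 < x < 1.
    by rewrite in_itv/= => /andP[h1 h2]; apply/andP; lra.
  have inFo x : x \in `]- e n, e n[ -> -1 < x < 1.
    by rewrite in_itv/= => /andP[h1 h2]; apply/andP; lra.
  rewrite (@continuous_FTC2 _ _ asin).
  - have := @asin_lepi2 R (e n); have := @asin_geNpi2 R (- e n).
    by rewrite -EFinB lee_fin; move=> h1 h2; have := h1 _; have := h2 _; lra.
  - lra.
  - apply: continuous_in_subspaceT => x; rewrite inE => /inF /andP[x1 x2].
    have x3 : 0 < 1 - x ^+ 2 by nra.
    have -> : arcsine_density = fun x => ((1 - x ^+ 2) `^ 2^-1)^-1.
      by apply/funext => y; rewrite /arcsine_density powRN.
    apply: (@continuous_comp _ _ _ (fun x : R => (1 - x ^+ 2) `^ 2^-1) GRing.inv); last first.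
      by apply: inv_continuous; rewrite gt_eqF// powR_gt0.
    apply: (@continuous_comp _ _ _ (fun x : R => 1 - x ^+ 2) (@powR R ^~ 2^-1)).
      by apply: cvgB; [exact: cvg_cst|exact: exprn_continuous].
    apply: differentiable_continuous; apply/derivable1_diffP.
    by apply: derivable_powR; rewrite in_itv/= x3.
  - split.
    + by move=> x /inFo /is_derive1_asin[].
    + apply: cvg_at_right_filter; apply: continuous_asin; lra.
    + apply: cvg_at_left_filter; apply: continuous_asin; lra.
  - move=> x /inFo h; rewrite derive1E; have [_ ->] := is_derive1_asin h.
    by rewrite /arcsine_density powRN powR12_sqrt//; move/andP: h => [h1 h2]; nra.
have UF : \bigcup_n F n = `]-1, 1[%classic.
  apply/seteqP; split => x /=.
    move=> [n _]; rewrite /F /= !in_itv/= => /andP[h1 h2].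
    by have /andP[h3 h4] := e0 n; lra.
  rewrite in_itv/= => /andP[x1 x2].
  have d0 : 0 < 1 - `|x| by rewrite subr_gt0 ltr_norml x1 x2.
  exists (Num.truncn (1 - `|x|)^-1) => //; rewrite /F /= in_itv/= -ler_norml /e.
  rewrite lerBrDr -lerBrDl -[leRHS]invrK lef_pV2 ?posrE ?invr_gt0//.
  by apply/ltW/(lt_trans (truncnS_gt _)); rewrite ltr_nat.
apply: (@le_lt_trans _ _ pi%:E); last by rewrite ltry.
have := @ge0_nondecreasing_set_cvg_integral _ (measurableTypeR R) R F (EFin \o arcsine_density) leb.
have ndF : nondecreasing_seq F.
  apply/nondecreasing_seqP => n; rewrite subsetEset; apply: subset_itv;
  by rewrite bnd_simp ?lerN2 lerB// lef_pV2 ?posrE// ler_nat.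
have mF n : measurable (F n) by exact: measurable_itv.
have mf n : measurable_fun (F n) (EFin \o arcsine_density).
  by apply/measurable_EFinP; apply: measurable_funTS; exact: measurable_arcsine_density.
have f0 n x : F n x -> (0 <= (EFin \o arcsine_density) x)%E.
  by move=> _; rewrite /= lee_fin powR_ge0.
rewrite UF => /(_ ndF mF mf f0) lim.
have <- := cvg_lim _ lim; last exact: ereal_hausdorff.
apply: lime_le; last exact: nearW.
by apply/cvg_ex; eexists; exact: lim.
Qed.

Lemma integrable_jacobi_weight : - (1 / 2) <= b -> b <= a ->
  leb.-integrable I (EFin \o w).
Proof.
move=> hb hab.
have mw D : measurable_fun D (EFin \o w).
  by apply/measurable_EFinP; apply: measurable_funTS; exact: measurable_jacobi_weight.
apply/integrableP; split; first exact: mw.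
under eq_integral do rewrite /= ger0_norm ?jacobi_weight_ge0//.
rewrite (@integral_itv_bndoo _ _ _ (fun x => (w x)%:E) true false); last exact: mw.
set K := 2 `^ (a + 2^-1) * 2 `^ (b + 2^-1).
have K0 : 0 <= K by rewrite mulr_ge0 ?powR_ge0.
apply: (@le_lt_trans _ _ (\int[leb]_(x in `](-1)%R, 1%R[) (K * arcsine_density x)%:E)%E).
  apply: ge0_le_integral => //.
  - by move=> x _; rewrite lee_fin jacobi_weight_ge0.
  - exact: mw.
  - apply/measurable_EFinP; apply: measurable_funTS; apply: measurable_funM => //.
    exact: measurable_arcsine_density.
  - move=> x; rewrite /= in_itv/= => xI.
    by rewrite lee_fin jacobi_weight_le_arcsine.
under eq_integral do rewrite EFinM.
rewrite ge0_integralZl_EFin//.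
- apply: lte_mul_pinfty => //; exact: arcsine_integral_lty.
- by move=> x _; rewrite lee_fin powR_ge0.
- by apply/measurable_EFinP; apply: measurable_funTS; exact: measurable_arcsine_density.
Qed.

End Weight.

(** * The weighted space for a finite exponent *)

Section FiniteExponent.
Variables (R : realType) (a b q : R).
Implicit Types (c : R) (f g : R -> R).
Hypothesis q1 : 1 <= q.
Local Notation leb := (@lebesgue_measure R).
Local Notation I := (`[-1, 1]%classic : set R).
Local Notation w := (jacobi_weight a b).

Let q0 : 0 < q. Proof. exact: lt_le_trans q1. Qed.

(** Multiplication by [w^(1/q)], extended by 0, embeds L_{w,q} isometrically
    in L_q of the line; inequalities and limits are pulled back along it. *)
Definition wlift (f : R -> R) : R -> R := (fun x => f x * w x `^ q^-1) \_ I.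

Lemma measurable_wlift f : measurable_fun I f -> measurable_fun setT (wlift f).
Proof.
move=> mf; apply/(measurable_restrictT _ (measurable_itv _)).
apply: measurable_funM => //; apply: measurable_funTS.
by apply: (measurableT_comp (measurable_powR _)); exact: measurable_jacobi_weight.
Qed.

Lemma wliftD f g : wlift (fun x => f x + g x) = (wlift f \+ wlift g)%R.
Proof.
apply/funext => x; rewrite /wlift /= !patchE; case: ifP => _ /=; last by rewrite addr0.
by rewrite mulrDl.
Qed.

Lemma wnorm_Lnorm f : wnorm a b q%:E f = Lnorm leb q%:E (EFin \o wlift f).
Proof.
rewrite unlock /wnorm; apply: (congr1 (fun z => z `^ q^-1)%E).
rewrite [LHS]integral_mkcond; apply: eq_integral => x _.
rewrite /wlift /= !patchE; case: ifP => _ /=; last first.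
  by rewrite normr0 powR0// gt_eqF.
rewrite normrM powRM// (ger0_norm (powR_ge0 _ _)) -powRrM mulVf ?gt_eqF//.
by rewrite powRr1// jacobi_weight_ge0.
Qed.

Lemma wnorm_finZ c f : measurable_fun I f ->
  wnorm a b q%:E (fun x => c * f x)%R = (`|c|%:E * wnorm a b q%:E f)%E.
Proof.
move=> mf; rewrite /wnorm.
rewrite (_ : (\int[leb]_(x in I) _)%E =
    ((`|c| `^ q)%:E * \int[leb]_(x in I) (`|f x| `^ q * w x)%:E)%E); last first.
  rewrite -ge0_integralZl_EFin ?powR_ge0//.
  - by apply: eq_integral => x _; rewrite normrM powRM// -mulrA EFinM.
  - by move=> x _; rewrite lee_fin mulr_ge0 ?powR_ge0 ?jacobi_weight_ge0.
  - by apply/measurable_EFinP; exact: measurable_powR_weight.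
rewrite poweRM ?lee_fin ?powR_ge0//; last first.
  apply: integral_ge0 => x _.
  by rewrite lee_fin mulr_ge0 ?powR_ge0 ?jacobi_weight_ge0.
by rewrite poweR_EFin -powRrM mulfV ?gt_eqF// powRr1.
Qed.

Lemma wnorm_fin_triangle f g : measurable_fun I f -> measurable_fun I g ->
  (wnorm a b q%:E (fun x => f x + g x)%R
   <= wnorm a b q%:E f + wnorm a b q%:E g)%E.
Proof.
move=> mf mg; rewrite !wnorm_Lnorm wliftD.
by apply: minkowski_EFin => //; exact: measurable_wlift.
Qed.

(** The weight is almost everywhere nonzero, so division by [w^(1/q)] is
    harmless. *)
Lemma wnorm_fin_eq0 f : measurable_fun I f -> wnorm a b q%:E f = 0%E ->
  {ae leb, forall x, I x -> f x = 0}.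
Proof.
move=> mf; rewrite wnorm_Lnorm => /Lnorm_eq0_eq0 H.
have {}H := H (proj2 (measurable_EFinP _ _) (measurable_wlift _ mf)).
have {}H := H q0.
apply: (@filterS2 _ _ (ae_filter_ringOfSetsType leb) _ _ _ _
  (jacobi_weight_ae_neq0 R a b) H) => x w0 + Ix.
rewrite /wlift /= patchE mem_set//= => /(_ Logic.I)[] /eqP.
by rewrite mulf_eq0 powR_eq0 (negbTE (w0 Ix)) orbF => /eqP.
Qed.

Lemma wnorm_fin_ae f g : measurable_fun I f -> measurable_fun I g ->
  {ae leb, forall x, I x -> f x = g x} -> wnorm a b q%:E f = wnorm a b q%:E g.
Proof.
move=> mf mg fg; rewrite /wnorm; apply: (congr1 (fun z => z `^ q^-1)%E).
apply: ge0_ae_eq_integral => //.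
- by apply/measurable_EFinP; exact: measurable_powR_weight.
- by apply/measurable_EFinP; exact: measurable_powR_weight.
- by move=> x _; rewrite lee_fin mulr_ge0 ?powR_ge0 ?jacobi_weight_ge0.
- by move=> x _; rewrite lee_fin mulr_ge0 ?powR_ge0 ?jacobi_weight_ge0.
- apply: (@filterS _ _ (ae_filter_ringOfSetsType leb) _ _ _ fg) => x fgx Ix.
  by rewrite fgx.
Qed.

Lemma Lw_fin_lin c f g : Lw a b q%:E f -> Lw a b q%:E g ->
  Lw a b q%:E (fun x => c * f x + g x).
Proof.
move=> [mf fy] [mg gy].
have mcf : measurable_fun I (fun x => c * f x) by exact: measurable_funM.
split; first exact: measurable_funD.
apply: le_lt_trans (wnorm_fin_triangle _ _ mcf mg) _.
rewrite wnorm_finZ//; apply: lte_add_pinfty; last exact: gy.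
by apply: lte_mul_pinfty; [rewrite lee_fin|by []|exact: fy].
Qed.

(** The sum of the lifted series is divided by [w^(1/q)].  Where [w] vanishes
    or outside [-1, 1] the lift of the remainder is 0, so its norm never
    exceeds that of the remainder of the lifted series. *)
Lemma Lw_fin_complete (u : nat -> R -> R) (M : R) :
  (forall k, Lw a b q%:E (u k)) ->
  (forall N, (\sum_(0 <= k < N) wnorm a b q%:E (u k) <= M%:E)%E) ->
  exists g, Lw a b q%:E g /\
    wnorm a b q%:E (fun x => \sum_(0 <= k < N) u k x - g x)%R
      @[N --> \oo] --> 0%E.
Proof.
move=> Lu uM.
have mu_ k : measurable_fun I (u k) by have [] := Lu k.
have uM' N : (\sum_(0 <= k < N) Lnorm leb q%:E (EFin \o wlift (u k)) <= M%:E)%E.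
  by under eq_bigr do rewrite -wnorm_Lnorm; exact: uM.
have [g0 mg0 lim] := @Lnorm_series_cvg _ _ R leb q q1 (fun k => wlift (u k)) M
  (fun k => measurable_wlift _ (mu_ k)) uM'.
pose g x := g0 x * w x `^ (- q^-1).
have mg : measurable_fun I g.
  apply: measurable_funTS; apply: measurable_funM => //.
  by apply: (measurableT_comp (measurable_powR _)); exact: measurable_jacobi_weight.
have mS N : measurable_fun I (fun x => \sum_(0 <= k < N) u k x) by exact: measurable_sum.
have mD N : measurable_fun I (fun x => \sum_(0 <= k < N) u k x - g x).
  exact: measurable_funB.
have {}lim : wnorm a b q%:E (fun x => \sum_(0 <= k < N) u k x - g x)%R
      @[N --> \oo] --> 0%E.
  apply: (@squeeze_cvge _ _ _ _ (cst 0%E) _ _ _ _ (cvg_cst _) lim).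
  apply: nearW => N; rewrite wnorm_Lnorm Lnorm_ge0/=.
  apply: le_Lnorm => //.
  - exact: measurable_wlift.
  - apply: measurable_funB => //; apply: measurable_sum => k.
    exact: measurable_wlift.
  move=> x; rewrite {1}/wlift patchE; case: ifP => [xI|_]; last by rewrite normr0.
  have [w0|w0] := eqVneq (w x) 0.
    by rewrite w0 powR0 ?invr_eq0 ?gt_eqF// mulr0 normr0.
  rewrite mulrBl /g powRN mulrAC mulfK ?powR_eq0 ?(negbTE w0)// mulr_suml.
  rewrite (_ : \sum_(0 <= k < N) _ = \sum_(0 <= k < N) wlift (u k) x)//.
  by apply: eq_bigr => k _; rewrite /wlift patchE xI.
exists g; split => //.
have LS N : Lw a b q%:E (fun x => \sum_(0 <= k < N) u k x).
  elim: N => [|N IH].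
    have := Lw_fin_lin (-1) (u 0%N) (u 0%N) (Lu 0%N) (Lu 0%N).
    congr (Lw _ _ _ _); apply/funext => x.
    by rewrite big_geq// mulN1r addNr.
  have := Lw_fin_lin 1 _ _ IH (Lu N); congr (Lw _ _ _ _); apply/funext => x.
  by rewrite mul1r big_nat_recr.
have := (nneg_cvge0P _ _ _).1 lim 1 ltr01.
move=> /(_ _)[|N _ /(_ N (leqnn N)) small].
  by move=> N; rewrite wnorm_Lnorm Lnorm_ge0.
have LD : Lw a b q%:E (fun x => \sum_(0 <= k < N) u k x - g x).
  by split; [exact: mD|apply: le_lt_trans small _; exact: ltry].
have := Lw_fin_lin (-1) _ _ LD (LS N); congr (Lw _ _ _ _); apply/funext => x.
by rewrite mulN1r opprB subrK.
Qed.

End FiniteExponent.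

(** * The space of continuous functions *)

Section UniformNorm.
Variables (R : realType) (a b : R).
Implicit Types (c : R) (f g : R -> R).
Local Notation I := (`[-1, 1]%classic : set R).

Lemma wnorm_unif_le f (K : \bar R) :
  (wnorm a b +oo%E f <= K)%E <-> (forall x, I x -> (`|f x|%:E <= K)%E).
Proof.
split=> [fK x Ix|fK].
  by apply: le_trans fK; apply: ereal_sup_ubound; exists x.
by apply: ge_ereal_sup => _ [x Ix <-]; exact: fK.
Qed.

Lemma wnorm_unif_ge f x : I x -> (`|f x|%:E <= wnorm a b +oo%E f)%E.
Proof. by move=> Ix; apply: ereal_sup_ubound; exists x. Qed.

Lemma itv0 : I 0.
Proof. by rewrite /= in_itv/= lerN10 ler01. Qed.

Lemma wnorm_unif_ge0 f : (0 <= wnorm a b +oo%E f)%E.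
Proof. by apply: le_trans (wnorm_unif_ge f _ itv0); rewrite lee_fin. Qed.

Lemma Lw_unif_lin c f g : Lw a b +oo%E f -> Lw a b +oo%E g ->
  Lw a b +oo%E (fun x => c * f x + g x).
Proof.
move=> cf cg x; apply: cvgD; last exact: cg.
by apply: cvgM; [exact: cvg_cst|exact: cf].
Qed.

Lemma wnorm_unif_lty f : Lw a b +oo%E f -> (wnorm a b +oo%E f < +oo)%E.
Proof.
move=> cf; have [M [_ fM]] := within_continuous_bounded _ _ cf.
apply: (@le_lt_trans _ _ (M + 1)%:E); last exact: ltry.
apply/wnorm_unif_le => x Ix; rewrite lee_fin.
by apply: fM; rewrite // ltrDl.
Qed.

Lemma wnorm_unifZ c f : wnorm a b +oo%E (fun x => c * f x) = (`|c|%:E * wnorm a b +oo%E f)%E.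
Proof.
apply/eqP; rewrite eq_le; apply/andP; split.
  apply/wnorm_unif_le => x Ix; rewrite normrM EFinM.
  by apply: lee_wpmul2l; [rewrite lee_fin|exact: wnorm_unif_ge].
have [->|c0] := eqVneq c 0.
  by rewrite normr0 mul0e; exact: wnorm_unif_ge0.
rewrite muleC -lee_pdivlMr ?normr_gt0//.
apply/wnorm_unif_le => x Ix.
rewrite lee_pdivlMr ?normr_gt0// -EFinM mulrC -normrM.
exact: (wnorm_unif_ge (fun x => c * f x)).
Qed.

Lemma wnorm_unif_triangle f g :
  (wnorm a b +oo%E (fun x => f x + g x)%R <= wnorm a b +oo%E f + wnorm a b +oo%E g)%E.
Proof.
apply/wnorm_unif_le => x Ix.
apply: (@le_trans _ _ (`|f x|%:E + `|g x|%:E)%E).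
  by rewrite -EFinD lee_fin ler_normD.
by apply: leeD; exact: wnorm_unif_ge.
Qed.

(** The Weierstrass M-test: the partial sums are within a tail of the
    numerical series of norms from the pointwise sum, uniformly on [-1, 1]. *)
Lemma Lw_unif_complete (u : nat -> R -> R) (M : R) :
  (forall k, Lw a b +oo%E (u k)) ->
  (forall N, (\sum_(0 <= k < N) wnorm a b +oo%E (u k) <= M%:E)%E) ->
  exists g, Lw a b +oo%E g /\
    wnorm a b +oo%E (fun x => \sum_(0 <= k < N) u k x - g x)%R
      @[N --> \oo] --> 0%E.
Proof.
move=> Lu uM.
pose m k := fine (wnorm a b +oo%E (u k)).
have mE k : (m k)%:E = wnorm a b +oo%E (u k).
  by rewrite fineK// ge0_fin_numE ?wnorm_unif_ge0//; exact: wnorm_unif_lty.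
have m_ge0 k : 0 <= m k by rewrite fine_ge0// wnorm_unif_ge0.
have u_le k x : I x -> `|u k x| <= m k.
  by move=> Ix; rewrite -lee_fin mE; exact: wnorm_unif_ge.
have m_cvg : cvgn (series m).
  apply: nondecreasing_is_cvgn.
    by apply/nondecreasing_series => n _ _.
  exists M => _ [N _ <-]; rewrite /series/= -lee_fin -sumEFin.
  by under eq_bigr do rewrite mE; exact: uM.
pose S N x := \sum_(0 <= k < N) u k x.
have S_dist i n x : I x -> (i <= n)%N -> `|S i x - S n x| <= series m n - series m i.
  move=> Ix lein; have -> : S n x = S i x + \sum_(i <= k < n) u k x.
    by rewrite /S (@big_cat_nat _ _ _ i 0 n).
  rewrite opprD addrA subrr sub0r normrN sub_series_geq//.
  by apply: le_trans (ler_norm_sum _ _ _) _; apply: ler_sum => k _; exact: u_le.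
pose g x := limn (S^~ x).
have S_cvg x : I x -> S N x @[N --> \oo] --> g x.
  move=> Ix; have := @normed_cvg R R^o (u^~ x); apply.
  apply: (@series_le_cvg _ (fun n => `|u n x|) m) => //.
  by move=> n; exact: u_le.
have g_dist x N : I x -> `|S N x - g x| <= limn (series m) - series m N.
  move=> Ix.
  have lim : `|S N x - S n x| @[n --> \oo] --> `|S N x - g x|.
    by apply: cvg_norm; apply: cvgB; [exact: cvg_cst|exact: S_cvg].
  rewrite -(cvg_lim _ lim)//; apply: limr_le.
    by apply/cvg_ex; eexists; exact: lim.
  exists N => // n /= Nn; apply: le_trans (S_dist _ _ _ Ix Nn) _.
  rewrite lerD2r; apply: nondecreasing_cvgn_le => //.
  by apply/nondecreasing_series => k _ _.
have tail0 (e : R) : 0 < e -> \forall N \near \oo, limn (series m) - series m N <= e.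
  move=> e0; have /cvgrPdist_le/(_ e e0) := m_cvg.
  by apply: filterS => n; apply: le_trans; exact: ler_norm.
have unif (e : R) : 0 < e -> \forall N \near \oo, forall x, I x -> `|S N x - g x| <= e.
  move=> e0; have := tail0 e e0; apply: filterS => n tn x Ix.
  exact: le_trans (g_dist _ _ Ix) tn.
exists g; split; last first.
  apply/nneg_cvge0P; first by move=> n; exact: wnorm_unif_ge0.
  move=> e e0; have := unif e e0; apply: filterS => N uN.
  by apply/wnorm_unif_le => x Ix; rewrite lee_fin; exact: uN.
have cS N : {within I, continuous (S N)}.
  elim: N => [|N IH].
    rewrite (_ : S 0%N = cst 0); first by move=> x; exact: cvg_cst.
    by apply/funext => x; rewrite /S big_geq.
  rewrite (_ : S N.+1 = (fun x => 1 * S N x + u N x)); first exact: Lw_unif_lin.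
  by apply/funext => x; rewrite /S big_nat_recr//= mul1r.
apply: (@uniform_limit_continuous_subspace _ _ _ (S @ \oo)).
- by exists 0%N => // n _; exact: cS.
- move=> Q /uniform_nbhs[E [entE subQ]].
  move: entE; rewrite -entourage_ballE => -[e /= e0 eE].
  have e20 : (0 : R) < e / 2 by exact: divr_gt0.
  have := unif _ e20; apply: filterS => N uN; apply: subQ => y Iy.
  apply: eE; rewrite /ball /= distrC.
  by apply: le_lt_trans (uN y Iy) _; rewrite ltr_pdivrMr// ltr_pMr // ltr1n.
Qed.

End UniformNorm.

(** * The weighted spaces for an arbitrary exponent *)

Variant exponent_spec (R : realType) : \bar R -> Prop :=
  | FiniteExponent q of 1 <= q : exponent_spec R q%:E
  | UniformExponent : exponent_spec R +oo%E.

Lemma exponentP (R : realType) (p : \bar R) : (1%:E <= p)%E -> exponent_spec R p.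
Proof. by case: p => [q|_|//]; rewrite ?lee_fin; [left|right]. Qed.

(** Linearity is stated for combinations [c * f + g]; this brings differences
    to that form. *)
Lemma subr_lin (R : realType) (f g : R -> R) :
  (fun x => f x - g x) = (fun x => -1 * g x + f x).
Proof. by apply/funext => x; rewrite mulN1r addrC. Qed.

Section WeightedSpaceTheory.
Variables (R : realType) (a b : R) (p : \bar R).
Hypothesis p1 : (1%:E <= p)%E.
Implicit Types (c : R) (f g : R -> R).
Local Notation I := (`[-1, 1]%classic : set R).
Local Notation leb := (@lebesgue_measure R).
Local Notation Lw := (Lw a b p).
Local Notation wnorm := (wnorm a b p).
Local Notation weq := (weq p).

Lemma Lw_lin c f g : Lw f -> Lw g -> Lw (fun x => c * f x + g x).
Proof.
case: (exponentP R p p1) => [q q1|].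
- exact: Lw_fin_lin.
- exact: Lw_unif_lin.
Qed.

Lemma wnorm_ge0 f : (0 <= wnorm f)%E.
Proof.
case: (exponentP R p p1) => [q q1|].
- exact: poweR_ge0.
- exact: wnorm_unif_ge0.
Qed.

Lemma wnorm_lty f : Lw f -> (wnorm f < +oo)%E.
Proof.
case: (exponentP R p p1) => [q q1|].
- by case.
- exact: wnorm_unif_lty.
Qed.

Lemma wnormZ c f : Lw f -> wnorm (fun x => c * f x) = (`|c|%:E * wnorm f)%E.
Proof.
case: (exponentP R p p1) => [q q1|].
- by move=> [mf _]; exact: wnorm_finZ.
- by move=> _; exact: wnorm_unifZ.
Qed.

Lemma wnorm_triangle f g : Lw f -> Lw g ->
  (wnorm (fun x => f x + g x)%R <= wnorm f + wnorm g)%E.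
Proof.
case: (exponentP R p p1) => [q q1|].
- by move=> [mf _] [mg _]; exact: wnorm_fin_triangle.
- by move=> _ _; exact: wnorm_unif_triangle.
Qed.

(** With [wnorm_weq], this makes the functions modulo [weq] a normed space. *)
Lemma weq_norm0 f g : Lw f -> Lw g -> wnorm (fun x => f x - g x) = 0%E -> weq f g.
Proof.
case: (exponentP R p p1) => [q q1|].
- move=> [mf _] [mg _] /(wnorm_fin_eq0 _ _ _ _ q1) H.
  have {}H := H (measurable_funB mf mg).
  apply: (@filterS _ _ (ae_filter_ringOfSetsType leb) _ _ _ H) => x Hx /set_mem Ix.
  by apply: subr0_eq; exact: Hx.
- move=> _ _ fg0 x /set_mem Ix; apply: subr0_eq; apply/eqP.
  have := wnorm_unif_ge _ a b (fun x => f x - g x) x Ix.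
  by rewrite fg0 lee_fin normr_le0.
Qed.

Lemma wnorm_weq f g : Lw f -> Lw g -> weq f g -> wnorm f = wnorm g.
Proof.
case: (exponentP R p p1) => [q q1|].
- move=> [mf _] [mg _] fg; apply: wnorm_fin_ae => //.
  apply: (@filterS _ _ (ae_filter_ringOfSetsType leb) _ _ _ fg) => x Hx Ix.
  by apply: Hx; exact: mem_set.
- move=> _ _ fg; congr ereal_sup; apply/seteqP; split => _ [x Ix <-] /=;
  by exists x => //; rewrite fg//; exact: mem_set.
Qed.

Lemma Lw_complete (u : nat -> R -> R) (M : R) :
  (forall k, Lw (u k)) ->
  (forall N, (\sum_(0 <= k < N) wnorm (u k) <= M%:E)%E) ->
  exists g, Lw g /\
    wnorm (fun x => \sum_(0 <= k < N) u k x - g x)%R @[N --> \oo] --> 0%E.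
Proof.
case: (exponentP R p p1) => [q q1|].
- exact: Lw_fin_complete.
- exact: Lw_unif_complete.
Qed.

Lemma weq_refl f : weq f f.
Proof.
case: p => [q||] //=; apply: aeW => //.
Qed.

Lemma weq_sym f g : weq f g -> weq g f.
Proof.
case: p => [q||] /= fg; [|by move=> x Ix; rewrite fg..].
by apply: (@filterS _ _ (ae_filter_ringOfSetsType leb) _ _ _ fg) => x Hx Ix; rewrite Hx.
Qed.

Lemma weq_lin c f f' g g' : weq f f' -> weq g g' ->
  weq (fun x => c * f x + g x) (fun x => c * f' x + g' x).
Proof.
case: p => [q||] /= ff gg; [|by move=> x Ix; rewrite ff ?gg..].
apply: (@filterS2 _ _ (ae_filter_ringOfSetsType leb) _ _ _ _ ff gg) => x Hx Hy Ix.
by rewrite Hx ?Hy.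
Qed.

Lemma weq_trans f g h : weq f g -> weq g h -> weq f h.
Proof.
case: p => [q||] /= fg gh; [|by move=> x Ix; rewrite fg ?gh..].
apply: (@filterS2 _ _ (ae_filter_ringOfSetsType leb) _ _ _ _ fg gh) => x Hx Hy Ix.
by rewrite Hx ?Hy.
Qed.

Lemma Lw_sub f g : Lw f -> Lw g -> Lw (fun x => f x - g x).
Proof. by move=> Lf Lg; rewrite subr_lin; exact: Lw_lin. Qed.

Lemma weq_sub f f' g g' : weq f f' -> weq g g' ->
  weq (fun x => f x - g x) (fun x => f' x - g' x).
Proof. by move=> ff gg; rewrite !subr_lin; exact: weq_lin. Qed.

End WeightedSpaceTheory.

(** * Uniqueness of Fourier-Jacobi series and linearity of the translation *)

Section ContinuousAe.
Variable R : realType.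
Local Notation I := (`[-1, 1]%classic : set R).
Local Notation leb := (@lebesgue_measure R).

(** A nonzero value would spread to a nondegenerate open subinterval, which
    is not negligible. *)
Lemma within_continuous_ae0 (f : R -> R) : {within I, continuous f} ->
  {ae leb, forall x, I x -> f x = 0} -> forall x, I x -> f x = 0.
Proof.
move=> cf [N [mN N0 subN]] x0 Ix0; apply: contrapT => /eqP fx0.
have fx0_gt : 0 < `|f x0| by rewrite normr_gt0.
have : f @ within I (nbhs x0) --> f x0.
  by rewrite nbhs_subspace_in//; exact: cf.
move=> /cvgrPdist_lt/(_ _ fx0_gt)/nbhs_ballP[e /= e0 He].
pose c := Num.max (-1) (x0 - e); pose d := Num.min 1 (x0 + e).
have /andP[x0l x0r] : -1 <= x0 <= 1 by move: Ix0; rewrite /= in_itv.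
have cd : c < d.
  rewrite /c /d gt_max !lt_min.
  by apply/andP; split; apply/andP; split; lra.
have sub : `]c, d[%classic `<=` N.
  move=> y /=; rewrite in_itv/= gt_max lt_min => /andP[/andP[y1 y2] /andP[y3 y4]].
  apply: subN => /= H.
  have Iy : I y by rewrite /= in_itv/= !ltW.
  have By : ball x0 e y by rewrite /ball /= ltr_norml; apply/andP; split; lra.
  by have := He y By Iy; rewrite H// subr0 ltxx.
have : (leb `]c, d[%classic <= leb N)%E.
  by apply: le_measure => //; rewrite inE.
rewrite lebesgue_measure_itv/= lte_fin cd N0 -EFinB lee_fin subr_le0.
by rewrite leNgt cd.
Qed.

Lemma integrable_scale (F : R -> R) c : leb.-integrable I (EFin \o F) ->
  leb.-integrable I (EFin \o (fun x => c * F x)).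
Proof.
move=> iF; have := @integrableZl _ _ _ leb I (measurable_itv _) c _ iF.
by apply: eq_integrable => // x _ /=; rewrite EFinM.
Qed.

Lemma poly_itv0 (q : {poly R}) : (forall x, I x -> q.[x] = 0) -> q = 0.
Proof.
move=> q0; apply/eqP/negP => /negP qn0.
pose n := size q.
pose rs := [seq (i%:R / n%:R : R) | i <- iota 0 n].
have n0 : (0 < n)%N by rewrite size_poly_gt0.
have nR : 0 < n%:R :> R by rewrite ltr0n.
have := @max_poly_roots _ q rs qn0; rewrite size_map size_iota ltnn => H.
suff : false by [].
apply: H.
- apply/allP => _ /mapP[i + ->]; rewrite mem_iota add0n => /andP[_ lin].
  rewrite /root q0//= in_itv/=; apply/andP; split.
    by apply: (@le_trans _ _ 0); [lra|exact: divr_ge0].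
  by rewrite ler_pdivrMr// mul1r ler_nat ltnW.
- rewrite map_inj_uniq ?iota_uniq// => i j /(congr1 (fun z => z * n%:R)).
  by rewrite !divfK ?gt_eqF// => /eqP; rewrite eqr_nat => /eqP.
Qed.

End ContinuousAe.

Section Uniqueness.
Variables (R : realType) (a b : R).
Hypothesis hb : - (1 / 2) <= b.
Hypothesis hab : b <= a.
Variable P : nat -> {poly R}.
Hypothesis hP : jacobi_polynomials a b P.
Implicit Types (c : R) (f g : R -> R) (p : \bar R).
Local Notation I := (`[-1, 1]%classic : set R).
Local Notation leb := (@lebesgue_measure R).
Local Notation w := (jacobi_weight a b).

(** For finite [q], [|f| <= 1 + |f|^q]; otherwise [f] is bounded.  Either way
    integrability of [w] suffices. *)
Lemma Lw_integrable p f : (1%:E <= p)%E -> Lw a b p f ->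
  leb.-integrable I (EFin \o (fun x => f x * w x)).
Proof.
have iw := integrable_jacobi_weight R a b hb hab.
have mw : measurable_fun I w.
  by apply: measurable_funTS; exact: measurable_jacobi_weight.
case/exponentP => [q q1|].
- move=> [mf fy].
  have q0 : 0 < q by exact: lt_le_trans q1.
  have mfq : measurable_fun I (fun x => `|f x| `^ q * w x).
    exact: measurable_powR_weight.
  have ifq : leb.-integrable I (EFin \o (fun x => `|f x| `^ q * w x)).
    apply/integrableP; split; first exact/measurable_EFinP.
    under eq_integral do
      rewrite /= ger0_norm ?mulr_ge0 ?powR_ge0 ?jacobi_weight_ge0//.
    by apply: lty_poweRy fy; rewrite invr_eq0 gt_eqF.
  have := @integrableD _ _ _ leb I (measurable_itv _) _ _ iw ifq.
  apply: le_integrable => //.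
    by apply/measurable_EFinP; exact: measurable_funM.
  move=> x Ix; rewrite /= lee_fin.
  have w0 := jacobi_weight_ge0 R a b x.
  have s0 : 0 <= w x + `|f x| `^ q * w x by rewrite addr_ge0// mulr_ge0// powR_ge0.
  rewrite normrM (ger0_norm w0) (ger0_norm s0).
  rewrite [leRHS](_ : _ = (1 + `|f x| `^ q) * w x); last by rewrite mulrDl mul1r.
  apply: ler_wpM2r => //.
  have [f1|f1] := leP `|f x| 1; first by rewrite (le_trans f1)// lerDl powR_ge0.
  apply: le_trans (le1r_powR (ltW f1) q1) _.
  by rewrite lerDr.
- move=> cf.
  have mf : measurable_fun I f.
    exact: subspace_continuous_measurable_fun.
  have := @integrableMr _ _ _ leb I (measurable_itv _) f (EFin \o w) mf
    (within_continuous_bounded _ _ cf) iw.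
  by apply: eq_integrable => // x _ /=; rewrite -EFinM.
Qed.

(** For [i < k], the factor [k + a - i] of the binomial coefficient is at
    least [1 + a >= 1/2]. *)
Lemma jacobi_at1_gt0 k : 0 < (P k).[1].
Proof.
have [_ _ ->] := hP; rewrite /gbinom divr_gt0 ?ltr0n ?fact_gt0//.
apply: prodr_gt0 => i _.
have : i.+1%:R <= k%:R :> R by rewrite ler_nat.
rewrite -natr1; move: hb hab; lra.
Qed.

(** Each [P_n] has degree exactly [n], so subtracting a multiple of it lowers
    the degree of a polynomial of degree [n]. *)
Lemma moments_of_jacobi (F : R -> R) : leb.-integrable I (EFin \o F) ->
  (forall k, \int[leb]_(x in I) (F x * (P k).[x]) = 0) ->
  forall q : {poly R}, \int[leb]_(x in I) (F x * q.[x]) = 0.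
Proof.
move=> iF F0; have [sP _ _] := hP.
suff H n : forall q : {poly R}, (size q <= n)%N -> \int[leb]_(x in I) (F x * q.[x]) = 0.
  by move=> q; exact: (H (size q)).
elim: n => [|n IH] q sq.
  move: sq; rewrite leqn0 size_poly_eq0 => /eqP ->.
  under eq_Rintegral do rewrite horner0 mulr0.
  by rewrite Rintegral_cst// mul0r.
pose c := q`_n / lead_coef (P n).
have lP : lead_coef (P n) != 0 by rewrite lead_coef_eq0 -size_poly_eq0 sP.
have sq' : (size (q - c *: P n)%R <= n)%N.
  apply/leq_sizeP => j; rewrite leq_eqVlt => /predU1P[<-|nj].
    have lE : (P n)`_n = lead_coef (P n) by rewrite lead_coefE sP.
    by rewrite coefB coefZ lE divfK// subrr.
  rewrite coefB coefZ (nth_default _ (leq_trans sq nj)).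
  by rewrite (@nth_default _ _ (P n)) ?sP// mulr0 subr0.
rewrite (_ : \int[leb]_(x in I) (F x * q.[x]) =
    \int[leb]_(x in I) (c * (F x * (P n).[x]) + F x * (q - c *: P n).[x])).
  rewrite RintegralD//.
  - by rewrite RintegralZl ?F0 ?IH ?mulr0 ?addr0//; exact: integrable_mul_poly.
  - by apply: integrable_scale; exact: integrable_mul_poly.
  - exact: integrable_mul_poly.
by apply: eq_Rintegral => x _; rewrite hornerD hornerN hornerZ; ring.
Qed.

Lemma jacobi_cE k f : leb.-integrable I (EFin \o (fun x => f x * w x)) ->
  jacobi_c a b P k f = \int[leb]_(x in I) (f x * w x * (P k).[x]) / (P k).[1].
Proof.
move=> iF; rewrite -RintegralZr//; last exact: integrable_mul_poly.
by apply: eq_Rintegral => x _; rewrite /jacobiR; ring.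
Qed.

Lemma fourier_jacobi_unique0 p f : (1%:E <= p)%E -> Lw a b p f ->
  (forall k, jacobi_c a b P k f = 0) -> weq p f (fun=> 0).
Proof.
move=> p1 Lf cf0.
have iF := Lw_integrable _ _ p1 Lf.
have mom k : \int[leb]_(x in I) (f x * w x * (P k).[x]) = 0.
  have := cf0 k; rewrite jacobi_cE// => /eqP.
  by rewrite mulf_eq0 invr_eq0 (gt_eqF (jacobi_at1_gt0 k)) orbF => /eqP.
have F0 := moments_ae0 _ _ iF (moments_of_jacobi _ iF mom).
have f0 : {ae leb, forall x, I x -> f x = 0}.
  apply: (@filterS2 _ _ (ae_filter_ringOfSetsType leb) _ _ _ _
    (jacobi_weight_ae_neq0 R a b) F0) => x w0 + Ix => /(_ Ix)/eqP.
  by rewrite mulf_eq0 (negbTE (w0 Ix)) orbF => /eqP.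
move: p p1 Lf => [q||] //= _ Lf.
  by apply: (@filterS _ _ (ae_filter_ringOfSetsType leb) _ _ _ f0) => x H /set_mem.
by move=> x /set_mem; exact: within_continuous_ae0.
Qed.

(** Otherwise [R_k] would have norm zero, hence vanish on [-1, 1].  Note that
    [fine] sends an infinite norm to 0, so finiteness has to be established
    too. *)
Lemma jacobi_mu_neq0 k : jacobi_mu a b P k != 0.
Proof.
have [sP _ _] := hP.
have cR : {within I, continuous (jacobiR P k)}.
  apply: continuous_subspaceT => x.
  by apply: cvgM; [exact: continuous_horner|exact: cvg_cst].
have mR : measurable_fun I (jacobiR P k) by exact: subspace_continuous_measurable_fun.
have q1 : 1 <= 2 :> R by rewrite ler1n.
have iw := integrable_jacobi_weight R a b hb hab.
have cR2 : {within I, continuous (fun x => jacobiR P k x ^+ 2)}.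
  by move=> x; apply: cvgM; exact: cR.
have mR2 : measurable_fun I (fun x => jacobiR P k x ^+ 2).
  exact: subspace_continuous_measurable_fun.
have iR2 := @integrableMr _ _ _ leb I (measurable_itv _) _ (EFin \o w) mR2
    (within_continuous_bounded _ _ cR2) iw.
have fin : (wnorm a b 2%:E (jacobiR P k) < +oo)%E.
  apply: poweR_lty; rewrite -ge0_fin_numE; last first.
    by apply: integral_ge0 => x _; rewrite lee_fin mulr_ge0 ?powR_ge0 ?jacobi_weight_ge0.
  apply: integrable_fin_num => //; move: iR2; apply: eq_integrable => // x _ /=.
  rewrite -EFinM; congr (_ * _)%:E.
  by rewrite powR_mulrn// real_normK// num_real.
rewrite /jacobi_mu invr_eq0 expf_eq0/=; apply/eqP => n0.
have {}n0 : wnorm a b 2%:E (jacobiR P k) = 0%E.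
  by rewrite -[LHS]fineK ?n0// ge0_fin_numE//; exact: poweR_ge0.
have R0 := within_continuous_ae0 _ _ cR (wnorm_fin_eq0 _ a b 2 q1 _ mR n0).
have : P k = 0.
  apply: poly_itv0 => x Ix; have := R0 x Ix; rewrite /jacobiR => /eqP.
  by rewrite mulf_eq0 invr_eq0 (gt_eqF (jacobi_at1_gt0 k)) orbF => /eqP.
by move=> Pk; have := sP k; rewrite Pk size_poly0.
Qed.

Lemma jacobi_c_lin p k c f g : (1%:E <= p)%E -> Lw a b p f -> Lw a b p g ->
  jacobi_c a b P k (fun x => c * f x + g x) =
  c * jacobi_c a b P k f + jacobi_c a b P k g.
Proof.
move=> p1 Lf Lg.
have iF := Lw_integrable _ _ p1 Lf.
have iG := Lw_integrable _ _ p1 Lg.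
rewrite !jacobi_cE//; last by exact: (Lw_integrable _ _ p1 (Lw_lin _ _ _ _ p1 _ _ _ Lf Lg)).
rewrite mulrA -mulrDl; congr (_ / _).
rewrite -RintegralZl//; last exact: integrable_mul_poly.
rewrite -RintegralD//.
- by apply: eq_Rintegral => x _; ring.
- by apply: integrable_scale; exact: integrable_mul_poly.
- exact: integrable_mul_poly.
Qed.

Lemma fourier_jacobi_unique p f g : (1%:E <= p)%E -> Lw a b p f -> Lw a b p g ->
  (forall k, fourier_jacobi_coef a b P k f = fourier_jacobi_coef a b P k g) ->
  weq p f g.
Proof.
move=> p1 Lf Lg fg.
have : weq p (fun x => -1 * g x + f x) (fun=> 0).
  apply: fourier_jacobi_unique0 => //; first exact: Lw_lin.
  move=> k; rewrite (jacobi_c_lin p)// mulN1r addrC; apply/eqP; rewrite subr_eq0.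
  have := fg k; rewrite /fourier_jacobi_coef => /(mulIf (jacobi_mu_neq0 k)) ->.
  by [].
move=> H; have := weq_lin _ _ 1 _ _ _ _ H (weq_refl _ p g).
by congr weq; apply/funext => x; ring.
Qed.

(** Both sides have the same Fourier-Jacobi coefficients. *)
Lemma translation_lin p T : (1%:E <= p)%E -> jacobi_translation a b P p T ->
  forall h c f g, 0 < h < pi -> Lw a b p f -> Lw a b p g ->
  weq p (T h (fun x => c * f x + g x)) (fun x => c * T h f x + T h g x).
Proof.
move=> p1 hT h c f g hpi Lf Lg.
have Lfg := Lw_lin _ _ _ _ p1 c _ _ Lf Lg.
have [LTf cTf] := hT h f hpi Lf.
have [LTg cTg] := hT h g hpi Lg.
have [LTfg cTfg] := hT h _ hpi Lfg.
apply: fourier_jacobi_unique => //; first exact: Lw_lin.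
move=> k; rewrite cTfg /fourier_jacobi_coef !(jacobi_c_lin p)//.
move: (cTf k) (cTg k); rewrite /fourier_jacobi_coef => ef eg.
by rewrite [RHS]mulrDl -[X in _ = X + _]mulrA ef eg; ring.
Qed.

End Uniqueness.

(** * Fractional differences *)

Section Binomial.
Variable R : realType.
Implicit Types beta : R.

Lemma gbinomS beta k : gbinom beta k.+1 * k.+1%:R = gbinom beta k * (beta - k%:R).
Proof.
rewrite /gbinom big_ord_recr/= factS natrM.
have h1 : k.+1%:R != 0 :> R by rewrite pnatr_eq0.
have h2 : k`!%:R != 0 :> R by rewrite pnatr_eq0 -lt0n fact_gt0.
by field; rewrite h2 nat1r.
Qed.

(** For [k >= beta] the recurrence reads
    [(k + 1) c_(k+1) = (k - beta) c_k] for the absolute values [c_k], that is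
    [beta c_k = k c_k - (k + 1) c_(k+1)].  The sum telescopes, and is bounded
    by [K c_K / beta] from any index [K > beta] on. *)
Lemma gbinom_abs_summable beta : 0 < beta ->
  exists M : R, forall N, \sum_(0 <= k < N) `|gbinom beta k| <= M.
Proof.
move=> b0; pose c k := `|gbinom beta k|.
have c0 k : 0 <= c k by exact: normr_ge0.
pose K := (Num.truncn beta).+1.
have bK : beta < K%:R by exact: truncnS_gt.
have rec k : (K <= k)%N -> k.+1%:R * c k.+1 = (k%:R - beta) * c k.
  move=> Kk; have bk : 0 <= k%:R - beta.
    by rewrite subr_ge0; apply/ltW/(lt_le_trans bK); rewrite ler_nat.
  rewrite -[k%:R - beta]ger0_norm// distrC -{1}[k.+1%:R]ger0_norm// -!normrM.
  by rewrite mulrC gbinomS mulrC.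
have tele n : beta * \sum_(K <= k < K + n) c k + (K + n)%:R * c (K + n)%N = K%:R * c K.
  elim: n => [|n IH]; first by rewrite addn0 big_geq// mulr0 add0r.
  rewrite addnS big_nat_recr ?leq_addr//= rec ?leq_addr// -IH.
  by ring.
exists (\sum_(0 <= k < K) c k + K%:R * c K / beta) => N.
apply: (@le_trans _ _ (\sum_(0 <= k < K + N) c k)).
  by rewrite (@big_cat_nat _ _ _ N 0 (K + N)) ?leq_addl//= lerDl sumr_ge0.
rewrite (@big_cat_nat _ _ _ K 0 (K + N)) ?leq_addr//= lerD2l.
rewrite ler_pdivlMr// mulrC -(tele N) lerDl.
exact: mulr_ge0.
Qed.

End Binomial.

Section FractionalDifference.
Variables (R : realType) (a b : R).
Hypothesis hb : - (1 / 2) <= b.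
Hypothesis hab : b <= a.
Variable P : nat -> {poly R}.
Hypothesis hP : jacobi_polynomials a b P.
Variable p : \bar R.
Hypothesis p1 : (1%:E <= p)%E.
Variable T : R -> (R -> R) -> R -> R.
Hypothesis hT : jacobi_translation a b P p T.
Hypothesis hTc : forall (h : R) (f : R -> R), 0 < h < pi -> Lw a b p f ->
  (wnorm a b p (T h f) <= wnorm a b p f)%E.
Variable r : R.
Hypothesis r0 : 0 < r.
Implicit Types (c t : R) (f g : R -> R).
Local Notation Lw := (Lw a b p).
Local Notation N := (wnorm a b p).
Local Notation weq := (weq p).
Local Notation D := (frac_diff a b p T r).
Local Notation partial := (frac_diff_partial T r).

Let lin := Lw_lin R a b p p1.
Let sub := Lw_sub R a b p p1.

Lemma Lw0 f : Lw f -> Lw (fun=> 0).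
Proof.
move=> Lf; have := sub _ _ Lf Lf; congr Lw.
by apply/funext => x; rewrite subrr.
Qed.

Lemma wnorm0 f : Lw f -> N (fun=> 0) = 0%E.
Proof.
move=> Lf; have := wnormZ R a b p p1 0 f Lf.
by rewrite normr0 mul0e => <-; congr wnorm; apply/funext => x; rewrite mul0r.
Qed.

Lemma wnorm_sub_weq f g : Lw f -> Lw g -> weq f g -> N (fun x => f x - g x) = 0%E.
Proof.
move=> Lf Lg fg; rewrite -(wnorm0 f Lf); apply: wnorm_weq => //.
- exact: sub.
- exact: Lw0 Lf.
- have := weq_sub R p _ _ _ _ fg (weq_refl R p g).
  by congr weq; apply/funext => x; rewrite subrr.
Qed.

Lemma wnormN f : Lw f -> N (fun x => - f x) = N f.
Proof.
move=> Lf; have := wnormZ R a b p p1 (-1) f Lf.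
rewrite normrN1 mul1e => <-; congr wnorm; apply/funext => x; by rewrite mulN1r.
Qed.

Lemma wnorm_subC f g : Lw f -> Lw g -> N (fun x => f x - g x) = N (fun x => g x - f x).
Proof.
move=> Lf Lg; rewrite -wnormN; last exact: sub.
by congr wnorm; apply/funext => x; rewrite opprB.
Qed.

Lemma wnorm_sub_le f g : Lw f -> Lw g -> (N (fun x => f x - g x)%R <= N f + N g)%E.
Proof.
move=> Lf Lg; rewrite -(wnormN g Lg); apply: wnorm_triangle => //.
have := lin (-1) _ _ Lg (Lw0 _ Lg); congr Lw.
by apply/funext => x; rewrite mulN1r addr0.
Qed.

Lemma wnorm_sub_trans f g h : Lw f -> Lw g -> Lw h ->
  (N (fun x => f x - h x)%R <= N (fun x => f x - g x)%R + N (fun x => g x - h x)%R)%E.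
Proof.
move=> Lf Lg Lh; apply: le_trans (wnorm_triangle _ _ _ _ p1 _ _ _ _); [|exact: sub..].
by rewrite (_ : (fun x => f x - g x + (g x - h x)) = (fun x => f x - h x))//;
  apply/funext => x; rewrite addrA subrK.
Qed.

Lemma wnorm_lim_unique (S : nat -> R -> R) g h :
  (forall n, Lw (S n)) -> Lw g -> Lw h ->
  N (fun x => S n x - g x) @[n --> \oo] --> 0%E ->
  N (fun x => S n x - h x) @[n --> \oo] --> 0%E -> weq g h.
Proof.
move=> LS Lg Lh Sg Sh; apply: (weq_norm0 R a b p p1) => //.
apply/eqP; rewrite eq_le wnorm_ge0// andbT; apply/lee_addgt0Pr => e e0.
rewrite add0e.
have e2 : 0 < e / 2 by rewrite divr_gt0.
have {}Sg := (nneg_cvge0P _ _ (fun n => wnorm_ge0 _ _ _ _ p1 _)).1 Sg _ e2.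
have {}Sh := (nneg_cvge0P _ _ (fun n => wnorm_ge0 _ _ _ _ p1 _)).1 Sh _ e2.
have [n [gn hn]] : exists n, (N (fun x => S n x - g x)%R <= (e / 2)%:E)%E /\
    (N (fun x => S n x - h x)%R <= (e / 2)%:E)%E.
  by near \oo => n; exists n; split; near: n.
apply: le_trans (wnorm_sub_trans g (S n) h _ _ _) _ => //.
rewrite wnorm_subC// [e in leRHS](splitr e) EFinD.
exact: leeD.
Unshelve. all: by end_near. Qed.

(** [T t] acts on representatives, and its linearity alone does not make it
    compatible with [weq].  But the norm of [T t (f - g)] is at most that of
    [f - g], which is 0. *)
Lemma translation_weq t f g : 0 < t < pi -> Lw f -> Lw g -> weq f g ->
  weq (T t f) (T t g).
Proof.
move=> tpi Lf Lg fg.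
have Tf := (hT t f tpi Lf).1; have Tg := (hT t g tpi Lg).1.
have Lgf := lin (-1) _ _ Lg Lf.
have Tgf := (hT t _ tpi Lgf).1.
apply: (weq_norm0 R a b p p1) => //; apply/eqP; rewrite eq_le wnorm_ge0// andbT.
have E := translation_lin _ _ _ hb hab _ hP _ _ p1 hT t (-1) g f tpi Lg Lf.
rewrite subr_lin -(wnorm_weq _ _ _ _ p1 _ _ Tgf _ E); last exact: lin.
apply: le_trans (hTc _ _ tpi Lgf) _.
by rewrite -subr_lin wnorm_sub_weq.
Qed.

Lemma Lw_iter t f k : 0 < t < pi -> Lw f -> Lw (iter k (T t) f).
Proof. by move=> tpi Lf; elim: k => //= k IH; exact: (hT t _ tpi IH).1. Qed.

Lemma wnorm_iter t f k : 0 < t < pi -> Lw f -> (N (iter k (T t) f) <= N f)%E.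
Proof.
move=> tpi Lf; elim: k => //= k IH.
by apply: le_trans IH; apply: hTc => //; exact: Lw_iter.
Qed.

Lemma partialS t f n : partial t f n.+1 =
  (fun x => (-1) ^+ n * gbinom (r / 2) n * iter n (T t) f x + partial t f n x).
Proof. by apply/funext => x; rewrite /frac_diff_partial big_nat_recr//= addrC. Qed.

Lemma partial0 t f : partial t f 0 = fun=> 0.
Proof. by apply/funext => x; rewrite /frac_diff_partial big_geq. Qed.

Lemma Lw_partial t f n : 0 < t < pi -> Lw f -> Lw (partial t f n).
Proof.
move=> tpi Lf; elim: n => [|n IH]; first by rewrite partial0; exact: Lw0 Lf.
by rewrite partialS; apply: lin => //; exact: Lw_iter.
Qed.

Lemma frac_diff_spec t f : 0 < t < pi -> Lw f -> Lw (D t f) /\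
  N (fun x => partial t f n x - D t f x) @[n --> \oo] --> 0%E.
Proof.
move=> tpi Lf.
pose u k x := (-1) ^+ k * gbinom (r / 2) k * iter k (T t) f x.
have Lu k : Lw (u k).
  have := lin ((-1) ^+ k * gbinom (r / 2) k) _ _ (Lw_iter t f k tpi Lf) (Lw0 f Lf).
  by congr Lw; apply/funext => x; rewrite addr0.
have [M Mle] := gbinom_abs_summable _ (r / 2) (divr_gt0 r0 (ltr0n _ 2)).
have Nf : N f \is a fin_num by rewrite ge0_fin_numE ?wnorm_lty// wnorm_ge0.
have uM n : (\sum_(0 <= k < n) N (u k) <= (M * fine (N f))%:E)%E.
  apply: (@le_trans _ _ (\sum_(0 <= k < n) (`|gbinom (r / 2) k| * fine (N f))%:E)%E).
    apply: lee_sum => k _; rewrite wnormZ//; last exact: Lw_iter.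
    rewrite normrM normrX normrN1 expr1n mul1r EFinM fineK//.
    by apply: lee_wpmul2l; [rewrite lee_fin|exact: wnorm_iter].
  rewrite sumEFin lee_fin -mulr_suml ler_wpM2r//.
  by rewrite fine_ge0// wnorm_ge0.
have [g [Lg gcvg]] := Lw_complete _ _ _ _ p1 u _ Lu uM.
have := @xgetPex _ (fun=> 0) [set g | Lw g /\
    N (fun x => partial t f n x - g x) @[n --> \oo] --> 0%E].
by apply; exists g.
Qed.

Section Commutation.
Variable A : (R -> R) -> R -> R.
Hypothesis hA : bounded_linear_operator a b p A.
Hypothesis hcomm : forall f h, Lw f -> 0 < h < pi -> weq (T h (A f)) (A (T h f)).

Let LA f : Lw f -> Lw (A f). Proof. by case: hA => + _ _ _; apply. Qed.

(** The error operator [I - A] commutes with the powers of [T t]: linearity of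
    [T t] and the commutation hypothesis move one factor at a time. *)
Lemma error_iter t f k : 0 < t < pi -> Lw f ->
  weq (iter k (T t) (fun x => f x - A f x))
      (fun x => iter k (T t) f x - A (iter k (T t) f) x).
Proof.
move=> tpi Lf; elim: k => [|k IH] /=; first exact: weq_refl.
have Lk := Lw_iter t f k tpi Lf; have LAk := LA _ Lk.
have Lfa := sub _ _ Lf (LA _ Lf).
apply: weq_trans (translation_weq _ _ _ tpi _ _ IH) _.
- exact: Lw_iter.
- exact: sub.
have := translation_lin _ _ _ hb hab _ hP _ _ p1 hT t (-1) _ _ tpi LAk Lk.
rewrite -subr_lin => /weq_trans; apply.
rewrite subr_lin.
by apply: weq_lin; [exact: hcomm|exact: weq_refl].
Qed.

Lemma error_partial t f n : 0 < t < pi -> Lw f ->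
  weq (partial t (fun x => f x - A f x) n)
      (fun x => partial t f n x - A (partial t f n) x).
Proof.
move=> tpi Lf; have [_ _ Alin _] := hA.
have L0 := Lw0 f Lf.
elim: n => [|n IH].
  rewrite !partial0; apply: weq_sym.
  have := Alin (-1) _ _ L0 L0.
  rewrite (_ : (fun x => -1 * 0 + 0) = fun=> 0); last by apply/funext => x; rewrite mulr0 addr0.
  move=> A0; have := weq_sub _ _ _ _ _ _ (weq_refl R p (fun=> 0)) A0.
  move=> /weq_trans; apply.
  rewrite (_ : (fun x => 0 - _) = (fun=> 0)); first exact: weq_refl.
  by apply/funext => x; rewrite mulN1r addNr subr0.
rewrite !partialS; set c := (-1) ^+ n * _.
have Ln := Lw_iter t f n tpi Lf; have Lp := Lw_partial t f n tpi Lf.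
apply: weq_trans (weq_lin _ _ c _ _ _ _ (error_iter t f n tpi Lf) IH) _.
have := weq_sub _ _ _ _ _ _ (weq_refl R p (fun x => c * iter n (T t) f x + partial t f n x))
  (Alin c _ _ Ln Lp).
move=> /weq_sym; apply: weq_trans.
rewrite [X in weq _ X](_ : _ = (fun x => c * (iter n (T t) f x - A (iter n (T t) f) x) +
   (partial t f n x - A (partial t f n) x))); first exact: weq_refl.
by apply/funext => x; ring.
Qed.

(** Both functions are limits of the same sequence up to [weq]: the n-th
    partial sum for [f - A f] is [S_n - A S_n] with [S_n] the partial sum for
    [f], and [I - A] is continuous. *)
Lemma wnorm_frac_diff_error t f : 0 < t < pi -> Lw f ->
  N (D t (fun x => f x - A f x)) = N (fun x => D t f x - A (D t f) x).
Proof.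
move=> tpi Lf; have Lfa := sub _ _ Lf (LA _ Lf).
have [LD Dcvg] := frac_diff_spec t f tpi Lf.
have [LDa Dacvg] := frac_diff_spec t _ tpi Lfa.
have [_ _ Alin [C AC]] := hA.
have LAD := LA _ LD; have LDAD := sub _ _ LD LAD.
have Lp n := Lw_partial t f n tpi Lf.
have Lpa n := Lw_partial t _ n tpi Lfa.
apply: wnorm_weq => //; apply: (wnorm_lim_unique (partial t (fun x => f x - A f x))) => //.
apply/nneg_cvge0P; first by move=> n; exact: wnorm_ge0.
(* [K] bounds the norm of [I - A]; the given bound [C] of [A] may be negative. *)
move=> e e0; pose K := 1 + Num.max C 0.
have K0 : 0 < K by rewrite /K ltr_pwDl// le_max lexx orbT.
have eK : 0 < e / K by exact: divr_gt0.
have := (nneg_cvge0P _ _ (fun n => wnorm_ge0 _ _ _ _ p1 _)).1 Dcvg _ eK.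
apply: filterS => n small.
pose z x := partial t f n x - D t f x.
have Lz : Lw z by exact: sub.
have zE : weq (fun x => partial t (fun y => f y - A f y) n x - (D t f x - A (D t f) x))
    (fun x => z x - A z x).
  apply: weq_trans (weq_sub _ _ _ _ _ _ (error_partial t f n tpi Lf) (weq_refl _ _ _)) _.
  have := Alin (-1) _ _ LD (Lp n).
  rewrite -subr_lin => /(weq_sub _ _ _ _ _ _ (weq_refl _ p z))/weq_sym; apply: weq_trans.
  rewrite [X in weq X _](_ : _ = (fun x => z x - (-1 * A (D t f) x + A (partial t f n) x))).
    exact: weq_refl.
  by apply/funext => x; rewrite /z; ring.
have LAz := LA _ Lz.
rewrite (wnorm_weq _ _ _ _ p1 _ _ _ _ zE); [|by apply: sub|exact: sub].
apply: le_trans (wnorm_sub_le _ _ Lz LAz) _.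
apply: (@le_trans _ _ (K%:E * N z)%E); last first.
  apply: (@le_trans _ _ (K%:E * (e / K)%:E)%E).
    by apply: lee_wpmul2l => //; rewrite lee_fin ltW.
  by rewrite -EFinM lee_fin mulrC divfK// gt_eqF.
rewrite /K EFinD ge0_muleDl ?lee_fin ?le_max ?lexx ?orbT// mul1e.
apply: leeD => //; apply: le_trans (AC _ Lz) _.
by apply: lee_wpmul2r; [exact: wnorm_ge0|rewrite lee_fin le_max lexx].
Qed.

End Commutation.
End FractionalDifference.

(** * The Hölder seminorm and the main equivalence *)

Lemma one_in_0pi (R : realType) : (0 : R) < 1 < (pi : R).
Proof.
by rewrite ltr01 /=; apply: lt_le_trans (pi_ge2 R); rewrite ltr1n.
Qed.

(** If [t <= h] then [h^(-alpha) <= t^(-alpha)], so each pair [(h, t)]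
    contributes at most what [(t, t)] does. *)
Lemma holder_sup_modulus (R : realType) (a b : R) (p : \bar R) T (r alpha : R) f :
  (1%:E <= p)%E -> 0 < alpha ->
  ereal_sup [set ((h `^ (- alpha))%R)%:E * modulus a b p T r f h | h in
     [set h : R | (0 < h)%R]]%E =
  ereal_sup [set ((t `^ (- alpha))%R)%:E * wnorm a b p (frac_diff a b p T r t f) | t in
     [set t : R | (0 < t < pi)%R]]%E.
Proof.
move=> p1 alpha0; set S := RHS.
have pow0 (t : R) : (0 <= (t `^ (- alpha))%:E)%E by rewrite lee_fin powR_ge0.
have term t : 0 < t < pi ->
    ((t `^ (- alpha))%:E * wnorm a b p (frac_diff a b p T r t f) <= S)%E.
  by move=> tpi; apply: ereal_sup_ubound; exists t.
have S0 : (0 <= S)%E.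
  have t1 := one_in_0pi R.
  by apply: le_trans (term 1 t1); rewrite mule_ge0// wnorm_ge0.
apply/eqP; rewrite eq_le; apply/andP; split.
- apply: ge_ereal_sup => _ [h /= h0 <-].
  rewrite powRN lee_pdivrMl ?powR_gt0//; apply: ge_ereal_sup => _ [t /= ht <-].
  have [tpi th] : 0 < t < pi /\ t <= h.
    move: ht; case: ltP => hpi /andP[t0 tle]; rewrite t0 ?tle/=.
      by rewrite (le_lt_trans tle).
    by rewrite (le_trans (ltW tle)).
  have /andP[t0 _] := tpi.
  have := term t tpi; rewrite powRN lee_pdivrMl ?powR_gt0// => /le_trans; apply.
  apply: lee_wpmul2r => //; rewrite lee_fin.
  by apply: ge0_ler_powR => //; rewrite ?nnegrE; exact: ltW.
- apply: ge_ereal_sup => _ [t /= tpi <-]; have /andP[t0 t1] := tpi.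
  apply: (@le_trans _ _ ((t `^ (- alpha))%:E * modulus a b p T r f t)%E).
    apply: lee_wpmul2l => //; apply: ereal_sup_ubound; exists t => //=.
    by rewrite t1 t0 lexx.
  by apply: ereal_sup_ubound; exists t.
Qed.

Theorem theorem4p3 (R : realType) (a b : R) (hb : - (1 / 2) <= b) (hab : b <= a)
    (P : nat -> {poly R}) (hP : jacobi_polynomials a b P)
    (p : \bar R) (hp : (1%:E <= p)%E)
    (T : R -> (R -> R) -> R -> R) (hT : jacobi_translation a b P p T)
    (hT_contraction : forall (h : R) (f : R -> R), 0 < h < pi -> Lw a b p f ->
       (wnorm a b p (T h f) <= wnorm a b p f)%E)
    (r alpha : R) (halpha : 0 < alpha) (hr : alpha <= r)
    (omega : (R -> R) -> R -> R) (homega : Omega_class a b p omega)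
    (L : nat -> (R -> R) -> R -> R)
    (hL : forall n, (0 < n)%N -> bounded_linear_operator a b p (L n))
    (hcomm : forall (f : R -> R) (n : nat) (h : R),
       Lw a b p f -> (0 < n)%N -> 0 < h < pi ->
       weq p (T h (L n f)) (L n (T h f)))
    (hequiv : equivalent_on (Lw a b p)
       (fun f n => wnorm a b p (fun x => f x - L n f x))
       (fun f n => (omega f n%:R^-1)%:E)) :
  equivalent_on (Holder a b p T r alpha)
    (fun f n => holder_norm a b p T r alpha (fun x => f x - L n f x))
    (fun f n => omega_holder a b p T r alpha omega f n%:R^-1).
Proof.
have r0 : 0 < r by exact: lt_le_trans hr.
have [omega_ge0 _ _] := homega.
have [C C0 equiv] := hequiv.
exists C => // f n [Lf _] n0.
have delta0 : 0 < n%:R^-1 :> R by rewrite invr_gt0 ltr0n.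
rewrite /holder_norm holder_sup_modulus// /omega_holder.
set SA := ereal_sup _; set SB := ereal_sup _.
have errE t : 0 < t < pi ->
    wnorm a b p (frac_diff a b p T r t (fun x => f x - L n f x)) =
    wnorm a b p (fun x => frac_diff a b p T r t f x - L n (frac_diff a b p T r t f) x).
  move=> tpi; apply: (wnorm_frac_diff_error _ _ _ hb hab P hP _ hp T hT hT_contraction r r0) => //.
    exact: hL.
  by move=> g h Lg hpi; exact: hcomm.
have LD t : 0 < t < pi -> Lw a b p (frac_diff a b p T r t f).
  by move=> tpi; have [] := frac_diff_spec _ a b P _ hp T hT hT_contraction r r0 t f tpi Lf.
have pow0 (t : R) : (0 <= (t `^ (- alpha))%:E)%E by rewrite lee_fin powR_ge0.
have termA t : 0 < t < pi -> ((t `^ (- alpha))%:E *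
    wnorm a b p (frac_diff a b p T r t (fun x => f x - L n f x)%R) <= SA)%E.
  by move=> tpi; apply: ereal_sup_ubound; exists t.
have termB t : 0 < t < pi -> ((t `^ (- alpha))%:E *
    (omega (frac_diff a b p T r t f) n%:R^-1)%:E <= SB)%E.
  move=> tpi; apply: ereal_sup_ubound; exists t => //.
  by rewrite powRN mulrC EFinM.
have t1 := one_in_0pi R.
have SA0 : (0 <= SA)%E.
  by apply: le_trans (termA 1 t1); rewrite mule_ge0// wnorm_ge0.
have SB0 : (0 <= SB)%E.
  apply: le_trans (termB 1 t1); rewrite mule_ge0// lee_fin.
  by apply: omega_ge0 => //; exact: LD.
have [eqA eqB] := equiv f n Lf n0.
have om0 : (0 <= (omega f n%:R^-1)%:E)%E by rewrite lee_fin omega_ge0.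
have N0 := wnorm_ge0 R a b p hp (fun x => f x - L n f x).
split.
- rewrite lee_pdivrMl// ge0_muleDr//; apply: leeD; first by rewrite -lee_pdivrMl.
  apply: ge_ereal_sup => _ [t /= tpi <-]; rewrite errE//.
  have [+ _] := equiv _ n (LD t tpi) n0; rewrite lee_pdivrMl// => E.
  apply: (@le_trans _ _ ((t `^ (- alpha))%:E *
      (C%:E * (omega (frac_diff a b p T r t f) n%:R^-1)%:E))%E).
    exact: lee_wpmul2l.
  rewrite muleCA; apply: lee_wpmul2l; first by rewrite lee_fin ltW.
  exact: termB.
- rewrite ge0_muleDr//; apply: leeD => //.
  apply: ge_ereal_sup => _ [t /= tpi <-].
  have [_ E] := equiv _ n (LD t tpi) n0.
  rewrite mulrC EFinM -powRN.
  apply: (@le_trans _ _ ((t `^ (- alpha))%:E *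
      (C%:E * wnorm a b p (frac_diff a b p T r t (fun x => f x - L n f x)%R)))%E).
    by rewrite errE//; exact: lee_wpmul2l.
  rewrite muleCA; apply: lee_wpmul2l; first by rewrite lee_fin ltW.
  exact: termA.
Qed.
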